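(* There is an algorithm that, given the Tutte polynomials $t(M;x,y)$ and $t(N;x,y)$ of finite matroids $M$ and $N$ on disjoint ground sets, computes the Tutte polynomial $t(M\Box N;x,y)$ of their free product in time polynomial in $|E(M)|+|E(N)|$.
   Context: The Tutte polynomial is $t(M;x,y)=\sum_{A\subseteq E(M)}(x-1)^{r(M)-r(A)}(y-1)^{|A|-r(A)}$. A flat is cyclic if it is a union of circuits; $\mathcal{Z}(M)$ is the set of cyclic flats of $M$. The free product $M\Box N$ is the matroid on $E(M)\cup E(N)$ whose cyclic flats are exactly the sets in $\mathcal{Z}$ and whose ranks on these sets are given by $r$, where: $\mathcal{Z}'=\{X: X\in\mathcal{Z}(M), X\ne E(M)\}\cup\{E(M)\cup Y: Y\in\mathcal{Z}(N), Y\ne\emptyset\}$; $\mathcal{Z}=\mathcal{Z}'\cup\{E(M)\}$ if $M$ has no isthmuses and $N$ has no loops, and $\mathcal{Z}=\mathcal{Z}'$ otherwise; $r(X)=r_M(X)$ for $X\subseteq E(M)$ and $r(E(M)\cup Y)=r(M)+r_N(Y)$. *)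

(* Defs.v *)
From HB Require Import structures.
From mathcomp Require Import all_boot all_order all_algebra.

Set Implicit Arguments.
Unset Strict Implicit.
Unset Printing Implicit Defensive.

Import GRing.Theory.
Local Open Scope ring_scope.

(** * Matroids *)

(* The ground set is a subset of an ambient finite type [T], so that unions
   and disjointness of ground sets are those of [{set T}]. *)
Record matroid (T : finType) := Matroid {
  ground : {set T};
  indep : {set {set T}};
  indep_ground : forall I : {set T}, I \in indep -> I \subset ground;
  indep0 : set0 \in indep;
  indep_sub : forall I J : {set T}, J \in indep -> I \subset J -> I \in indep;
  indep_augment : forall I J : {set T}, I \in indep -> J \in indep ->
    (#|I| < #|J|)%N -> exists2 e, e \in J :\: I & e |: I \in indep }.

Section MatroidNotions.
Variables (T : finType) (M : matroid T).
Implicit Types A X C B : {set T}.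

Definition rank A : nat :=
  \max_(I : {set T} | (I \in indep M) && (I \subset A)) #|I|.

Definition circuits : {set {set T}} :=
  [set C | minset (fun A => (A \subset ground M) && (A \notin indep M)) C].

Definition bases : {set {set T}} :=
  [set B | maxset (fun A => A \in indep M) B].

Definition loop (e : T) : bool := [set e] \in circuits.

Definition isthmus (e : T) : bool :=
  (e \in ground M) && [forall B in bases, e \in B].

Definition flat X : bool :=
  (X \subset ground M) &&
  [forall e in ground M :\: X, (rank X < rank (e |: X))%N].

Definition cyclic X : bool :=
  [exists S : {set {set T}}, (S \subset circuits) && (X == cover S)].

Definition cyclic_flats : {set {set T}} := [set X | flat X && cyclic X].

(* With the conventions of [polyXY], the indeterminate x is ['X] and y is
   ['Y], i.e. ['X%:P]: the coefficient of x^i y^j in [p] is [p`_i`_j].  The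
   truncated subtractions are exact, as r(A) <= r(M) and r(A) <= |A|. *)
Definition tutte : {poly {poly int}} :=
  \sum_(A in powerset (ground M))
     ('X - 1) ^+ (rank (ground M) - rank A) * ('Y - 1) ^+ (#|A| - rank A).

End MatroidNotions.

(** * The free product *)

Section FreeProduct.
Variables (T : finType) (M N : matroid T).

Definition fp_cyclic_flats' : {set {set T}} :=
  [set X in cyclic_flats M | X != ground M] :|:
  [set ground M :|: Y | Y in cyclic_flats N & Y != set0].

Definition fp_cyclic_flats : {set {set T}} :=
  if [forall e, ~~ isthmus M e] && [forall e, ~~ loop N e]
  then ground M |: fp_cyclic_flats'
  else fp_cyclic_flats'.

(* A matroid is determined by its cyclic flats and their ranks, so at most one
   [P] satisfies this; that one does is a theorem of matroid theory. *)
Definition is_free_product (P : matroid T) : Prop :=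
  [/\ ground P = ground M :|: ground N,
      cyclic_flats P = fp_cyclic_flats,
      forall X : {set T}, X \in fp_cyclic_flats -> X \subset ground M ->
        rank P X = rank M X &
      forall Y : {set T}, Y \subset ground N ->
        ground M :|: Y \in fp_cyclic_flats ->
        rank P (ground M :|: Y) = (rank M (ground M) + rank N Y)%N].

End FreeProduct.

(** * Algorithms and running time *)

(* Programs for a random access machine with the logarithmic cost criterion
   (Cook and Reckhow; Aho, Hopcroft and Ullman), which is polynomially
   equivalent to Turing machines.  Registers hold integers and are indexed by
   integers.  Control flow is structured instead of given by jumps. *)
Inductive expr :=
  | Const of int
  | Reg of expr                  (* content of the register with that index *)
  | Add of expr & expr
  | Sub of expr & expr
  | Mul of expr & expr.

Inductive program :=
  | Skip
  | Store of expr & expr         (* index, value *)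
  | Seq of program & program
  | IfPos of expr & program & program
  | WhilePos of expr & program.

Definition memory := int -> int.

Definition update (m : memory) (a v : int) : memory :=
  fun b => if b == a then v else m b.

(* l(0) = 1 and l(z) = floor(log2 |z|) + 1 otherwise. *)
Definition bitlen (z : int) : nat := (trunc_log 2 `|z|).+1.

Fixpoint eval (m : memory) (e : expr) : int :=
  match e with
  | Const z => z
  | Reg e1 => m (eval m e1)
  | Add e1 e2 => eval m e1 + eval m e2
  | Sub e1 e2 => eval m e1 - eval m e2
  | Mul e1 e2 => eval m e1 * eval m e2
  end.

Fixpoint expr_cost (m : memory) (e : expr) : nat :=
  match e with
  | Const z => bitlen z
  | Reg e1 =>
      expr_cost m e1 + bitlen (eval m e1) + bitlen (m (eval m e1))
  | Add e1 e2 | Sub e1 e2 | Mul e1 e2 =>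
      expr_cost m e1 + expr_cost m e2
      + bitlen (eval m e1) + bitlen (eval m e2)
  end%N.

(* [exec c m t m']: started on [m], [c] halts at cost [t] with memory [m']. *)
Inductive exec : program -> memory -> nat -> memory -> Prop :=
  | exec_skip m : exec Skip m 1 m
  | exec_store m a e :
      exec (Store a e) m
        (expr_cost m a + expr_cost m e
         + bitlen (eval m a) + bitlen (eval m e))%N
        (update m (eval m a) (eval m e))
  | exec_seq c1 c2 m m1 m2 t1 t2 :
      exec c1 m t1 m1 -> exec c2 m1 t2 m2 ->
      exec (Seq c1 c2) m (t1 + t2)%N m2
  | exec_if_true e c1 c2 m m1 t :
      0 < eval m e -> exec c1 m t m1 ->
      exec (IfPos e c1 c2) m (expr_cost m e + bitlen (eval m e) + t)%N m1
  | exec_if_false e c1 c2 m m1 t :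
      eval m e <= 0 -> exec c2 m t m1 ->
      exec (IfPos e c1 c2) m (expr_cost m e + bitlen (eval m e) + t)%N m1
  | exec_while_true e c m m1 m2 t1 t2 :
      0 < eval m e -> exec c m t1 m1 -> exec (WhilePos e c) m1 t2 m2 ->
      exec (WhilePos e c) m
        (expr_cost m e + bitlen (eval m e) + t1 + t2)%N m2
  | exec_while_false e c m :
      eval m e <= 0 ->
      exec (WhilePos e c) m (expr_cost m e + bitlen (eval m e))%N m.

(* A word is given in registers 0, 1, 2, ...; all other registers are 0. *)
Definition input_memory (w : seq int) : memory :=
  fun a => if a is Posz i then w`_i else 0.

Definition holds_output (m : memory) (w : seq int) : Prop :=
  forall i : nat, (i < size w)%N -> m i%:Z = w`_i.

Definition computes_within (c : program) (w w' : seq int) (b : nat) : Prop :=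
  exists t m, [/\ exec c (input_memory w) t m, (t <= b)%N & holds_output m w'].

(* Self-delimiting encoding by the dense table of coefficients: each list of
   coefficients is preceded by its length.  Being prefix-free, it can be read
   off a memory without knowing the length of the word. *)
Definition encode_poly (p : {poly int}) : seq int := (size p)%:Z :: p.

Definition encode_poly2 (p : {poly {poly int}}) : seq int :=
  (size p)%:Z :: flatten [seq encode_poly q | q : {poly int} <- p].

(* Main.v *)
Require Import Defs.
From mathcomp Require Import all_boot all_order all_algebra.
From mathcomp Require Import zify ring lra.

(* In the free product P of M and N, the rank of the union of subsets X of E(M)
   and Y of E(N) is the minimum of r_M(X) + |Y| and r(M) + r_N(Y).  If (a, n) and
   (b, m) are the corank and nullity of X in M and of Y in N, then those of the
   union in P are (b + (a - m), n + (m - a)), with truncated subtractions.  Hence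
   t(P; x, y) is the sum of C_a D_m (x-1)^(a-m) (y-1)^(m-a), where C_a is the
   coefficient of w^a in t(M; w + 1, y) and D_m that of w^m in t(N; x, w + 1).

   A polynomial in x and y is packed into the integer which is its value at
   y = 4 * 8^n and x = y^(n+1), where 2^n = t(M; 2, 2) t(N; 2, 2).  These bases
   exceed twice the absolute values of all digits that occur, so digits of either
   sign are recovered by division with rounding to the nearest integer, and a
   number is 0 exactly when all its digits are: the loops that unpack the result
   stop at the degrees required by the output format.  The numbers C_a and D_m are
   themselves the digits of t(M; w + 1, y) and t(N; x, w + 1) in base
   w = x^(n+1).

   Only the number of steps is counted along the verification; the sizes of the
   integers, hence the logarithmic costs, are bounded by a syntactic criterion. *)

Set Implicit Arguments.
Unset Strict Implicit.
Unset Printing Implicit Defensive.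

Import Order.TTheory GRing.Theory Num.Theory.

(** * The rank function of the free product *)

Section Rank.
Variables (T : finType) (M : matroid T).
Implicit Types A B C I J X Z : {set T}.

Lemma card_indep_le_rank A I : I \in indep M -> I \subset A -> #|I| <= rank M A.
Proof.
move=> iI sIA.
by apply: (@leq_bigmax_cond _ (fun I => (I \in indep M) && (I \subset A))
  (fun I : {set T} => #|I|)); rewrite iI.
Qed.

Lemma rank_witness A :
  exists I, [/\ I \in indep M, I \subset A & #|I| = rank M A].
Proof.
have ne : 0 < #|[pred I : {set T} | (I \in indep M) && (I \subset A)]|.
  by apply/card_gt0P; exists set0; rewrite inE indep0 sub0set.
have [I /andP[iI sIA] eI] := eq_bigmax_cond (fun I : {set T} => #|I|) ne.
by exists I; split=> //; rewrite -eI.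
Qed.

Lemma rankS A B : A \subset B -> rank M A <= rank M B.
Proof.
move=> sAB; have [I [iI sIA <-]] := rank_witness A.
exact: card_indep_le_rank iI (subset_trans sIA sAB).
Qed.

Lemma rank_le_card A : rank M A <= #|A|.
Proof. by have [I [_ sIA <-]] := rank_witness A; apply: subset_leq_card. Qed.

Lemma rank_le_addD A Z : rank M A <= rank M Z + #|A :\: Z|.
Proof.
have [I [iI sIA <-]] := rank_witness A.
rewrite -(cardsID Z I) leq_add //; last by rewrite subset_leq_card ?setSD.
by apply: card_indep_le_rank (subsetIr _ _); apply: indep_sub iI (subsetIl _ _).
Qed.

Lemma indep_extend I : I \in indep M -> exists2 B, B \in bases M & I \subset B.
Proof.
move=> iI; have [B mB sIB] := @maxset_exists _ (fun A => A \in indep M) I iI.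
by exists B; rewrite ?inE.
Qed.

Lemma circuit_ground C : C \in circuits M -> C \subset ground M.
Proof. by rewrite inE => /minsetp/andP[]. Qed.

Lemma circuit_dep C : C \in circuits M -> C \notin indep M.
Proof. by rewrite inE => /minsetp/andP[]. Qed.

Lemma circuit_in A : A \subset ground M -> A \notin indep M ->
  exists2 C, C \in circuits M & C \subset A.
Proof.
move=> sA dA.
pose p := fun A => (A \subset ground M) && (A \notin indep M).
have [|C mC sCA] := @minset_exists _ p A; first by rewrite /p sA.
by exists C; rewrite ?inE.
Qed.

Lemma circuitD1_indep C e : C \in circuits M -> e \in C -> C :\ e \in indep M.
Proof.
move=> cC eC; have sC := circuit_ground cC; apply/negPn/negP => dC.
move: cC; rewrite inE => /minsetP[_ /(_ (C :\ e))].
rewrite (subset_trans _ sC) ?subD1set //= dC => /(_ isT isT) eq_C.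
by move: eC; rewrite -{1}eq_C setD11.
Qed.

(** If [e] lies in a circuit [C], a basis extending [C :\ e] avoids [e], since otherwise it would
    contain [C]. *)
Lemma cyclic_no_isthmus e : cyclic M (ground M) -> ~~ isthmus M e.
Proof.
case/existsP=> S /andP[/subsetP sS /eqP defE]; apply/negP=> /andP[eE /forall_inP eB].
move: eE; rewrite defE => /bigcupP[C /sS cC eC].
have [B bB sCB] := indep_extend (circuitD1_indep cC eC).
have iB : B \in indep M by move: bB; rewrite inE => /maxsetp.
case/negP: (circuit_dep cC); apply: indep_sub iB _.
by rewrite -(setD1K eC) subUset sub1set eB.
Qed.

Lemma flat0_no_loop e : flat M set0 -> ~~ loop M e.
Proof.
case/andP=> _ /forall_inP flat0; apply/negP=> le.
have eE : e \in ground M by move: (circuit_ground le); rewrite sub1set.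
have := flat0 e; rewrite setD0 setU0 => /(_ eE).
have [I [iI sI <-]] := rank_witness [set e]; move: sI.
rewrite subset1 => /orP[] /eqP defI; last first.
  by rewrite defI cards0.
by case/negP: (circuit_dep le); rewrite -defI.
Qed.

(* A minimiser of [rank Z + #|A :\: Z|] of least rank, and of largest size
   among those, is a flat without coloops. *)
Lemma cyclic_flat_witness A : A \subset ground M ->
  exists2 Z, Z \in cyclic_flats M & rank M A = rank M Z + #|A :\: Z|.
Proof.
move=> sA.
pose p Z := (Z \subset ground M) && (rank M Z + #|A :\: Z| <= rank M A).
(* As [#|T| - #|Z|] is less than [#|T|.+1], this weight encodes the lexicographic order: rank first,
   then decreasing size. *)
pose f Z := rank M Z * #|T|.+1 + (#|T| - #|Z|).
have pA : p A by rewrite /p sA setDv cards0 addn0 /=.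
case: (arg_minnP f pA) => Z /andP[sZ leZ] minZ.
have leT (B : {set T}) : #|B| <= #|T| by apply: max_card.
exists Z; last by apply/eqP; rewrite eqn_leq leZ rank_le_addD.
rewrite inE; apply/andP; split.
  rewrite /flat sZ; apply/forall_inP=> e; rewrite inE => /andP[eZ eE].
  rewrite ltnNge; apply/negP=> le_r.
  have cZ : #|e |: Z| = #|Z|.+1 by rewrite cardsU1 eZ.
  have cD : #|A :\: (e |: Z)| <= #|A :\: Z|.
    by rewrite subset_leq_card // setDS // subsetUr.
  have/minZ : p (e |: Z).
    by rewrite /p subUset sub1set eE sZ (leq_trans (leq_add le_r cD)).
  have := leT (e |: Z); rewrite /f cZ => leZT.
  have -> : rank M (e |: Z) = rank M Z.
    by apply/eqP; rewrite eqn_leq le_r rankS // subsetUr.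
  by rewrite leq_add2l; lia.
apply/existsP; exists [set C in circuits M | C \subset Z].
apply/andP; split; first by apply/subsetP=> C; rewrite inE => /andP[].
rewrite eqEsubset; apply/andP; split; last first.
  by apply/bigcupsP=> C; rewrite inE => /andP[].
apply/subsetP=> e eZ; have cZ := cardsD1 e Z; rewrite eZ in cZ.
(* If deleting [e] lowers the rank, [Z :\ e] is a minimiser of smaller rank. Otherwise a largest
   independent subset [I] of [Z :\ e] is also largest in [Z], so [e |: I] contains a circuit through
   [e]. *)
have [le_r | lt_r] := leqP (rank M Z) (rank M (Z :\ e)); last first.
  have cD : #|A :\: (Z :\ e)| <= (#|A :\: Z|).+1.
    have sD : A :\: (Z :\ e) \subset e |: (A :\: Z).
      by apply/subsetP=> x; rewrite !inE; case: (x == e) => //=.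
    by apply: leq_trans (subset_leq_card sD) _; rewrite cardsU1; case: (e \in _).
  have/minZ : p (Z :\ e).
    rewrite /p (subset_trans _ sZ) ?subD1set //= (leq_trans _ leZ) //.
    by apply: leq_trans (leq_add (leqnn _) cD) _; rewrite addnS -addSn leq_add2r.
  by have := leT Z; rewrite /f; nia.
have [I [iI sI cI]] := rank_witness (Z :\ e).
have eI : e \notin I by apply/negP=> /(subsetP sI); rewrite setD11.
have sIZ : I \subset Z by apply: subset_trans sI (subD1set _ _).
have sJ : e |: I \subset Z by rewrite subUset sub1set eZ.
have [|C cC sC] := circuit_in (subset_trans sJ sZ).
  apply/negP=> /card_indep_le_rank/(_ sJ); rewrite cardsU1 eI cI.
  by rewrite add1n ltnNge le_r.
apply/bigcupP; exists C; first by rewrite inE cC (subset_trans sC).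
apply/negPn/negP=> eC; case/negP: (circuit_dep cC); apply: indep_sub iI _.
apply/subsetP=> x xC; move/subsetP: sC => /(_ x xC); rewrite !inE.
by case/predU1P=> // defx; rewrite -defx xC in eC.
Qed.

Lemma cyclic_flat_sub Z : Z \in cyclic_flats M -> Z \subset ground M.
Proof. by rewrite inE => /andP[/andP[]]. Qed.

End Rank.

(** * The rank formula *)

Section FreeProductRank.
Variables (T : finType) (M N P : matroid T).
Hypotheses (dMN : [disjoint ground M & ground N]) (fpP : is_free_product M N P).
Variables X Y : {set T}.
Hypotheses (sX : X \subset ground M) (sY : Y \subset ground N).

Let E := ground M.
Let F := ground N.

Lemma free_product_ground : ground P = E :|: F.
Proof. by case: fpP. Qed.

Let dE (A B : {set T}) : A \subset E -> B \subset F -> A :&: B = set0.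
Proof.
move=> sA sB; apply: disjoint_setI0; apply: disjointWl sA _.
exact: disjointWr sB dMN.
Qed.

Let rank_le_left Z : Z \in fp_cyclic_flats M N -> Z \subset E ->
  rank P (X :|: Y) <= rank M Z + (#|X :\: Z| + #|Y|).
Proof.
case: fpP => _ _ rkE _ fZ sZ; rewrite -rkE //.
apply: leq_trans (rank_le_addD P _ Z) _; rewrite leq_add2l setDUl.
by apply: leq_trans (leq_card_setU _ _) _; rewrite leq_add2l subset_leq_card ?subsetDl.
Qed.

Let rank_le_right W : E :|: W \in fp_cyclic_flats M N -> W \subset F ->
  rank P (X :|: Y) <= rank M E + rank N W + #|Y :\: W|.
Proof.
case: fpP => _ _ _ rkF fW sW; rewrite -rkF //.
apply: leq_trans (rank_le_addD P _ (E :|: W)) _; rewrite leq_add2l.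
rewrite subset_leq_card // setDUl subUset; apply/andP; split.
  apply/subsetP=> x; rewrite !inE negb_or => /andP[/andP[xE _] xX].
  by rewrite (subsetP sX _ xX) in xE.
by rewrite setDS // subsetUr.
Qed.

Let fp_left Z : Z \in cyclic_flats M -> Z != E -> Z \in fp_cyclic_flats M N.
Proof.
move=> cZ nZ; have fZ : Z \in fp_cyclic_flats' M N.
  by rewrite in_setU in_set cZ nZ.
by rewrite /fp_cyclic_flats; case: ifP => _ //; rewrite in_setU1 fZ orbT.
Qed.

Let fp_right W : W \in cyclic_flats N -> W != set0 -> E :|: W \in fp_cyclic_flats M N.
Proof.
move=> cW nW; have fW : E :|: W \in fp_cyclic_flats' M N.
  by rewrite in_setU; apply/orP; right; apply/imsetP; exists W => //; rewrite in_set cW.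
by rewrite /fp_cyclic_flats; case: ifP => _ //; rewrite in_setU1 fW orbT.
Qed.

(** A witness for E(M) other than E(M), or a nonempty witness for the empty set, always yields a
    member of the family. If the witnesses are E(M) and the empty set themselves, then M has no
    isthmuses and N no loops, so that E(M) is a member. *)
Let rank_le_base : rank P (X :|: Y) <= rank M E + #|Y|.
Proof.
have [Z cZ rZ] := cyclic_flat_witness (subxx E).
have [W cW rW] := cyclic_flat_witness (sub0set F).
have r0 : rank N set0 = 0 by apply/eqP; rewrite -leqn0 -(@cards0 T) rank_le_card.
have [defZ|nZ] := eqVneq Z E; last first.
  apply: leq_trans (rank_le_left (fp_left cZ nZ) (cyclic_flat_sub cZ)) _.
  by rewrite rZ addnA leq_add2r leq_add2l subset_leq_card ?setSD.
have [defW|nW] := eqVneq W set0; last first.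
  apply: leq_trans (rank_le_right (fp_right cW nW) (cyclic_flat_sub cW)) _.
  move: rW; rewrite r0 set0D cards0 addn0 => <-.
  by rewrite addn0 leq_add2l subset_leq_card ?subsetDl.
have fE : E \in fp_cyclic_flats M N.
  rewrite /fp_cyclic_flats ifT ?setU11 //; apply/andP; split.
    apply/forallP=> e; apply: cyclic_no_isthmus.
    by move: cZ; rewrite defZ inE => /andP[].
  apply/forallP=> e; apply: flat0_no_loop.
  by move: cW; rewrite defW inE => /andP[].
apply: leq_trans (rank_le_left fE (subxx _)) _.
have /eqP-> : X :\: E == set0 by rewrite setD_eq0.
by rewrite cards0.
Qed.

(** Each upper bound comes from a cyclic flat that computes the rank of [X] or of [Y], with
    [rank_le_base] when that flat is E(M) or empty respectively. For the lower bound, a cyclic flat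
    of [P] that computes the rank of the union lies in E(M) or contains it, and yields one term of
    the minimum accordingly. *)
Lemma free_product_rank :
  rank P (X :|: Y) = minn (rank M X + #|Y|) (rank M (ground M) + rank N Y).
Proof.
apply/eqP; rewrite eqn_leq leq_min -andbA; apply/and3P; split.
- have [Z cZ ->] := cyclic_flat_witness sX.
  have [->|nZ] := eqVneq Z E; last first.
    by rewrite -addnA; apply: rank_le_left (fp_left cZ nZ) (cyclic_flat_sub cZ).
  by apply: leq_trans rank_le_base _; rewrite leq_add2r leq_addr.
- have [W cW ->] := cyclic_flat_witness sY.
  have [->|nW] := eqVneq W set0; last first.
    by rewrite addnA; apply: rank_le_right (fp_right cW nW) (cyclic_flat_sub cW).
  by apply: leq_trans rank_le_base _; rewrite leq_add2l setD0 leq_addl.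
have sXY : X :|: Y \subset ground P by rewrite free_product_ground setUSS.
have [V cV ->] := cyclic_flat_witness sXY.
case: fpP => _ cP rkE rkF; rewrite cP in cV.
rewrite geq_min.
have [sVE|] := boolP (V \subset E).
  rewrite (rkE _ cV sVE); apply/orP; left.
  rewrite setDUl cardsU.
  have -> : Y :\: V = Y.
    by apply/setDidPl; apply: disjointWr sVE _; rewrite disjoint_sym; apply: disjointWr sY dMN.
  have sXV : X :\: V \subset E by apply: subset_trans sX; apply: subsetDl.
  by rewrite (dE sXV sY) cards0 subn0 addnA leq_add2r rank_le_addD.
move=> nV; have [W sW defV] : exists2 W : {set T}, W \subset F & V = E :|: W.
  have fV : V \in fp_cyclic_flats' M N.
    move: cV; rewrite /fp_cyclic_flats; case: ifP => // _.
    by rewrite in_setU1 => /predU1P[defV|//]; rewrite defV subxx in nV.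
  move: fV; rewrite in_setU => /orP[].
    by rewrite in_set => /andP[/cyclic_flat_sub sV]; rewrite sV in nV.
  case/imsetP=> W; rewrite in_set => /andP[cW _] ->.
  by exists W => //; apply: cyclic_flat_sub cW.
rewrite defV rkF -?defV //; apply/orP; right; rewrite -addnA leq_add2l.
apply: leq_trans (rank_le_addD N _ W) _; rewrite leq_add2l subset_leq_card //.
apply/subsetP=> x; rewrite defV !inE negb_or => /andP[-> xY]; rewrite xY orbT !andbT.
by apply/negP=> xE; have := dE (subxx E) sY => /setP/(_ x); rewrite !inE xE xY.
Qed.

End FreeProductRank.

Local Open Scope ring_scope.

(** * Tutte polynomials *)

(** Regroups a sum over sets by exponent; this turns sums over digits back into sums over subsets of
    the ground set. *)
Lemma sum_coef_monomials (I : finType) (D : {pred I}) (c : I -> int)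
    (f : I -> nat) (g : nat -> int) : let p := \sum_(A in D) c A *: 'X^(f A) in
  \sum_(i < size p) p`_i * g i = \sum_(A in D) c A * g (f A) :> int.
Proof.
(* A range that contains all exponents [f A] as well as the indices below [size p]; cancellation may
   make [size p] smaller than some of the exponents. *)
move=> p; pose K := (maxn (size p) (\max_(A in D) f A)).+1.
have leK : (size p <= K)%N by rewrite ltnW // ltnS leq_maxl.
have -> : \sum_(i < size p) p`_i * g i = \sum_(i < K) p`_i * g i.
  rewrite (big_ord_widen K (fun i => p`_i * g i)) // [RHS](bigID (fun i : 'I_K => (i < size p)%N)) /=.
  by rewrite [X in _ + X]big1 ?addr0 // => i; rewrite -leqNgt => /(nth_default 0)->; rewrite mul0r.
have coefp' i : p`_i = \sum_(A in D) c A * (i == f A)%:R.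
  by rewrite coef_sum; apply: eq_bigr => A _; rewrite coefZ coefXn.
transitivity (\sum_(i < K) \sum_(A in D) c A * (i == f A :> nat)%:R * g i).
  by apply: eq_bigr => i _; rewrite coefp' big_distrl.
rewrite exchange_big; apply: eq_bigr => A DA.
have ltA : (f A < K)%N.
  by rewrite ltnS leq_max; apply/orP; right; apply: leq_bigmax_cond.
rewrite (bigD1 (Ordinal ltA)) //= eqxx mulr1 big1 ?addr0 // => i ni.
by rewrite (_ : (i == f A :> nat) = false) ?mulr0 ?mul0r //; apply: negbTE.
Qed.

Lemma coef_Xsub1_exp_le (k i : nat) : `|(('X - 1 : {poly int}) ^+ k)`_i| <= 2 ^+ k.
Proof.
elim: k i => [|k IHk] i; first by rewrite coef1; case: eqP.
rewrite exprS mulrBl mul1r coefB coefXM exprS; case: eqP => [_|_].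
  by rewrite sub0r normrN; have := IHk i; have := ler0n int (2 ^ k); rewrite natrX; lra.
set p := _ ^+ k in IHk *.
by have := ler_normB p`_i.-1 p`_i; have := IHk i; have := IHk i.-1; lra.
Qed.

Section Tutte.
Variables (T : finType) (M : matroid T).
Implicit Types A : {set T}.

Local Notation n := #|ground M|.
Definition corank A := (rank M (ground M) - rank M A)%N.
Definition nullity A := (#|A| - rank M A)%N.

Lemma corank_le A : (corank A <= n)%N.
Proof. by apply: leq_trans (leq_subr _ _) (rank_le_card _ _). Qed.

Lemma nullity_le A : A \subset ground M -> (nullity A <= n)%N.
Proof. by move=> sA; apply: leq_trans (leq_subr _ _) (subset_leq_card sA). Qed.

Lemma tutteE : tutte M =
  \sum_(A in powerset (ground M)) ('X - 1) ^+ corank A * (('X - 1) ^+ nullity A)%:P.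
Proof. by apply: eq_bigr => A _; rewrite polyC_exp polyCB. Qed.

Lemma horner_tutte (x y : int) : (tutte M).[x%:P].[y] =
  \sum_(A in powerset (ground M)) (x - 1) ^+ corank A * (y - 1) ^+ nullity A.
Proof.
rewrite tutteE !horner_sum; apply: eq_bigr => A _.
by rewrite !(hornerM, horner_exp, hornerC, hornerD, hornerN, hornerX).
Qed.

(** At x = y = 2 every subset contributes 1. This is how the program obtains a number that measures
    the ground set. *)
Lemma horner_tutte22 : (tutte M).[2%:P].[2] = 2 ^+ n.
Proof.
rewrite horner_tutte (eq_bigr (fun=> 1)) => [|A _].
  by rewrite sumr_const card_powerset natrX.
by rewrite -[2]/(1 + 1) addrK !expr1n mulr1.
Qed.

Lemma coef_tutte i : (tutte M)`_i =
  \sum_(A in powerset (ground M)) (('X - 1 : {poly int}) ^+ corank A)`_i *: ('X - 1) ^+ nullity A.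
Proof.
rewrite tutteE coef_sum; apply: eq_bigr => A _; rewrite coefMC.
have -> : ('X - 1 : {poly {poly int}}) = map_poly polyC ('X - 1).
  by rewrite rmorphB /= map_polyX rmorph1.
by rewrite -rmorphXn coef_map /= mul_polyC.
Qed.

(** There are 2^n subsets, and each contributes a product of two binomial coefficients, both at most
    2^n in absolute value. *)
Lemma coef_tutte_le i j : `|(tutte M)`_i`_j| <= 8 ^+ n.
Proof.
rewrite coef_tutte coef_sum; apply: le_trans (ler_norm_sum _ _ _) _.
have -> : 8 ^+ n = \sum_(A in powerset (ground M)) (2 ^+ n * 2 ^+ n : int).
  by rewrite sumr_const card_powerset -(mulr_natr (_ * _)) natrX -!exprMn.
apply: ler_sum => A; rewrite powersetE => sA; rewrite coefZ normrM.
apply: ler_pM => //; apply: le_trans (coef_Xsub1_exp_le _ _) _.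
  by rewrite ler_eXn2l // corank_le.
by rewrite ler_eXn2l // nullity_le.
Qed.

Lemma size_tutte : (size (tutte M) <= n.+1)%N.
Proof.
rewrite tutteE; apply: leq_trans (size_sum _ _ _) _; apply/bigmax_leqP => A _.
rewrite mulrC mul_polyC; apply: leq_trans (size_scale_leq _ _) _.
by have := size_exp_XsubC (corank A) (1 : {poly int}); rewrite polyC1 => ->; rewrite ltnS corank_le.
Qed.

Lemma size_coef_tutte (i : nat) : (size ((tutte M)`_i)%R <= n.+1)%N.
Proof.
rewrite coef_tutte; apply: leq_trans (size_sum _ _ _) _; apply/bigmax_leqP => A.
rewrite powersetE => sA; apply: leq_trans (size_scale_leq _ _) _.
by have := size_exp_XsubC (nullity A) (1 : int); rewrite polyC1 => ->; rewrite ltnS nullity_le.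
Qed.

(** This is t(M; w + 1, y) as a polynomial in w, with coefficients C_a; likewise [nullity_poly] is
    t(M; x, w + 1), with coefficients D_m. *)
Definition corank_poly (y : int) : {poly int} :=
  \sum_(A in powerset (ground M)) (y - 1) ^+ nullity A *: 'X^(corank A).
Definition nullity_poly (x : int) : {poly int} :=
  \sum_(A in powerset (ground M)) (x - 1) ^+ corank A *: 'X^(nullity A).

Lemma horner_corank_poly y w : (corank_poly y).[w] = (tutte M).[(w + 1)%:P].[y].
Proof.
rewrite horner_tutte horner_sum; apply: eq_bigr => A _.
by rewrite hornerZ hornerXn mulrC addrK.
Qed.

Lemma horner_nullity_poly x w : (nullity_poly x).[w] = (tutte M).[x%:P].[w + 1].
Proof.
rewrite horner_tutte horner_sum; apply: eq_bigr => A _.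
by rewrite hornerZ hornerXn addrK.
Qed.

Lemma size_corank_poly y : (size (corank_poly y) <= n.+1)%N.
Proof.
apply: leq_trans (size_sum _ _ _) _; apply/bigmax_leqP => A _.
by apply: leq_trans (size_scale_leq _ _) _; rewrite size_polyXn ltnS corank_le.
Qed.

Lemma size_nullity_poly x : (size (nullity_poly x) <= n.+1)%N.
Proof.
apply: leq_trans (size_sum _ _ _) _; apply/bigmax_leqP => A; rewrite powersetE => sA.
by apply: leq_trans (size_scale_leq _ _) _; rewrite size_polyXn ltnS nullity_le.
Qed.

Let coef_bound (z : int) (f g : {set T} -> nat) i : 1 <= z ->
    (forall A, A \subset ground M -> (g A <= n)%N) ->
  `|(\sum_(A in powerset (ground M)) (z - 1) ^+ g A *: 'X^(f A))`_i| <= 2 ^+ n * z ^+ n.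
Proof.
move=> z1 gn; rewrite coef_sum; apply: le_trans (ler_norm_sum _ _ _) _.
have -> : 2 ^+ n * z ^+ n = \sum_(A in powerset (ground M)) z ^+ n.
  by rewrite sumr_const card_powerset -(mulr_natl (z ^+ n)) natrX.
apply: ler_sum => A; rewrite powersetE => sA; rewrite coefZ coefXn normrM normrX.
have -> : `|z - 1| = z - 1 by rewrite ger0_norm ?subr_ge0.
have le1 : (z - 1) ^+ g A <= z ^+ n.
  apply: le_trans (_ : z ^+ g A <= _); last by rewrite ler_weXn2l ?gn.
  by rewrite lerXn2r ?nnegrE; lia.
by case: eqP; rewrite ?mulr1 ?mulr0 //= => _; rewrite exprn_ge0 //; lia.
Qed.

Lemma coef_corank_poly_le y i : 1 <= y -> `|(corank_poly y)`_i| <= 2 ^+ n * y ^+ n.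
Proof. by move=> y1; apply: coef_bound y1 nullity_le. Qed.

Lemma coef_nullity_poly_le x i : 1 <= x -> `|(nullity_poly x)`_i| <= 2 ^+ n * x ^+ n.
Proof. by move=> x1; apply: coef_bound x1 _ => A _; apply: corank_le. Qed.

End Tutte.

(** * The Tutte polynomial of the free product *)

Section FreeProductTutte.
Variables (T : finType) (M N P : matroid T).
Hypotheses (dMN : [disjoint ground M & ground N]) (fpP : is_free_product M N P).

Lemma big_powersetU (R : nmodType) (E F : {set T}) (h : {set T} -> R) :
  [disjoint E & F] ->
  \sum_(C in powerset (E :|: F)) h C =
  \sum_(A in powerset E) \sum_(B in powerset F) h (A :|: B).
Proof.
move=> dEF; rewrite pair_big /=.
rewrite (reindex_onto (fun AB : {set T} * {set T} => AB.1 :|: AB.2)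
  (fun C => (C :&: E, C :&: F))) /=; last first.
  by move=> C; rewrite powersetE => sC; rewrite -setIUr; apply/setIidPl.
apply: eq_bigl => -[A B] /=; rewrite !powersetE.
apply/andP/andP => [[sAB /eqP[<- <-]]|[sA sB]]; first by rewrite !subsetIr.
have AF : A :&: F = set0.
  by apply: disjoint_setI0; apply: disjointWl sA dEF.
have BE : B :&: E = set0.
  by rewrite setIC; apply: disjoint_setI0; apply: disjointWr sB dEF.
rewrite setUSS // !setIUl AF BE setU0 set0U; split=> //.
by apply/eqP; congr (_, _); apply/setIidPl.
Qed.

Lemma card_free_product_ground : #|ground P| = (#|ground M| + #|ground N|)%N.
Proof.
have [-> _ _ _] := fpP; rewrite cardsU disjoint_setI0 //.
by rewrite cards0 subn0.
Qed.

(** By the rank formula, the corank is the maximum of b and a + b - m, and the nullity that of n and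
    n + m - a, in the notation a, n for [A] and b, m for [B]. *)
Lemma free_product_corank (A B : {set T}) : A \subset ground M -> B \subset ground N ->
  corank P (A :|: B) = (corank N B + (corank M A - nullity N B))%N /\
  nullity P (A :|: B) = (nullity M A + (nullity N B - corank M A))%N.
Proof.
move=> sA sB; rewrite /corank /nullity.
have [-> _ _ _] := fpP.
rewrite !(free_product_rank dMN fpP) // cardsU.
have -> : A :&: B = set0.
  by apply: disjoint_setI0; apply: disjointWl sA _; apply: disjointWr sB dMN.
have := rankS M sA; have := rankS N sB; have := rank_le_card M A.
have := rank_le_card N B; have := rank_le_card N (ground N).
by rewrite cards0; lia.
Qed.

(** The factors with exponents b and n are absorbed in the coefficients D_m and C_a. Only the
    truncated differences couple the two sums. *)
Lemma free_product_tutte (x y : int) :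
  let p := corank_poly M y in let q := nullity_poly N x in
  \sum_(i < size p) p`_i *
     (\sum_(j < size q) q`_j * ((x - 1) ^+ (i - j) * (y - 1) ^+ (j - i))) =
  (tutte P).[x%:P].[y].
Proof.
move=> p q.
pose g i := \sum_(j < size q) q`_j * ((x - 1) ^+ (i - j) * (y - 1) ^+ (j - i)).
rewrite (sum_coef_monomials _ _ _ g) horner_tutte.
have [-> _ _ _] := fpP; rewrite big_powersetU //.
apply: eq_bigr => A; rewrite powersetE => sA.
rewrite /g (sum_coef_monomials _ _ _
  (fun j => (x - 1) ^+ (corank M A - j) * (y - 1) ^+ (j - corank M A))).
rewrite big_distrr /=; apply: eq_bigr => B; rewrite powersetE => sB.
have [-> ->] := free_product_corank sA sB; rewrite !exprD [RHS]mulrACA mulrA.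
by congr (_ * _); apply: mulrC.
Qed.

End FreeProductTutte.

(** * A structured language and its compilation *)

(* Scalar [k] lives in register [Negz k = -(k+1)], and cell [i] of the array in
   register [i], so that the array initially holds the input. *)
Inductive sexpr :=
  | SConst of int
  | SVar of nat
  | SAdd of sexpr & sexpr
  | SSub of sexpr & sexpr
  | SMul of sexpr & sexpr.

Inductive cmd :=
  | Nop
  | Assign of nat & sexpr
  | Read of nat & nat
  | Write of nat & sexpr
  | Then of cmd & cmd
  | If of sexpr & cmd & cmd
  | While of sexpr & cmd.

Definition state := (seq int * (nat -> int))%type.

Fixpoint seval (s : seq int) (e : sexpr) : int :=
  match e with
  | SConst z => z
  | SVar k => s`_k
  | SAdd e1 e2 => seval s e1 + seval s e2
  | SSub e1 e2 => seval s e1 - seval s e2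
  | SMul e1 e2 => seval s e1 * seval s e2
  end.

Definition upd (mu : nat -> int) (i : nat) (v : int) : nat -> int :=
  fun j => if j == i then v else mu j.

(** Array accesses are possible only at nonnegative addresses, so they never reach a register that
    holds a scalar. *)
Inductive cexec : cmd -> state -> nat -> state -> Prop :=
  | cexec_nop st : cexec Nop st 1 st
  | cexec_set k e s mu : cexec (Assign k e) (s, mu) 1 (set_nth 0 s k (seval s e), mu)
  | cexec_read k j i s mu : s`_j = Posz i ->
      cexec (Read k j) (s, mu) 1 (set_nth 0 s k (mu i), mu)
  | cexec_write j e i s mu : s`_j = Posz i ->
      cexec (Write j e) (s, mu) 1 (s, upd mu i (seval s e))
  | cexec_then c1 c2 st st1 st2 t1 t2 :
      cexec c1 st t1 st1 -> cexec c2 st1 t2 st2 -> cexec (Then c1 c2) st (t1 + t2)%N st2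
  | cexec_if e c1 c2 st st1 t :
      cexec (if 0 < seval st.1 e then c1 else c2) st t st1 ->
      cexec (If e c1 c2) st t.+1 st1
  | cexec_while_true e c st st1 st2 t1 t2 :
      0 < seval st.1 e -> cexec c st t1 st1 -> cexec (While e c) st1 t2 st2 ->
      cexec (While e c) st (t1 + t2).+1 st2
  | cexec_while_false e c st :
      seval st.1 e <= 0 -> cexec (While e c) st 1 st.

Fixpoint compile_expr (e : sexpr) : expr :=
  match e with
  | SConst z => Const z
  | SVar k => Reg (Const (Negz k))
  | SAdd e1 e2 => Defs.Add (compile_expr e1) (compile_expr e2)
  | SSub e1 e2 => Defs.Sub (compile_expr e1) (compile_expr e2)
  | SMul e1 e2 => Defs.Mul (compile_expr e1) (compile_expr e2)
  end.

Fixpoint compile (c : cmd) : program :=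
  match c with
  | Nop => Skip
  | Assign k e => Store (Const (Negz k)) (compile_expr e)
  | Read k j => Store (Const (Negz k)) (Reg (compile_expr (SVar j)))
  | Write j e => Store (compile_expr (SVar j)) (compile_expr e)
  | Then c1 c2 => Seq (compile c1) (compile c2)
  | If e c1 c2 => IfPos (compile_expr e) (compile c1) (compile c2)
  | While e c => WhilePos (compile_expr e) (compile c)
  end.

Definition represents (m : memory) (st : state) : Prop :=
  (forall k, m (Negz k) = st.1`_k) /\ (forall i, m (Posz i) = st.2 i).

Lemma eval_compile m st e : represents m st -> eval m (compile_expr e) = seval st.1 e.
Proof.
case=> ms _; elim: e => [z|k|e1 IH1 e2 IH2|e1 IH1 e2 IH2|e1 IH1 e2 IH2] /=;
by rewrite ?IH1 ?IH2.
Qed.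

Lemma represents_set m s mu k v : represents m (s, mu) ->
  represents (update m (Negz k) v) (set_nth 0 s k v, mu).
Proof.
move=> [ms mm]; split=> [j|i] /=; rewrite /update; last by rewrite /= mm.
rewrite nth_set_nth /= -ms; case: (eqVneq j k) => [->|nk]; rewrite ?eqxx //.
by rewrite ifN //; apply: contra nk => /eqP[->].
Qed.

Lemma represents_write m s mu i v : represents m (s, mu) ->
  represents (update m (Posz i) v) (s, upd mu i v).
Proof. by move=> [ms mm]; split=> [j|j] /=; rewrite /update /upd //= mm. Qed.

(** * Sizes of numbers and logarithmic cost *)

Section Cost.

(* A scalar of level [l] may be assigned polynomials of weighted degree at most
   [l] in the other ones, where [lv k] is the weight of scalar [k] and [la] the
   weight of the array.  Scalars of level 0 may not be assigned. *)
Variables (lv : nat -> nat) (la : nat).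

(* [K] bounds the sizes of the expressions in the program and the indices of
   its variables, [D] the levels and degrees. *)
Variables (K D : nat).

Fixpoint deg (e : sexpr) : nat :=
  match e with
  | SConst _ => 0
  | SVar k => lv k
  | SAdd e1 e2 | SSub e1 e2 => maxn (deg e1) (deg e2)
  | SMul e1 e2 => deg e1 + deg e2
  end.

Fixpoint esize (e : sexpr) : nat :=
  match e with
  | SConst _ | SVar _ => 1
  | SAdd e1 e2 | SSub e1 e2 | SMul e1 e2 => (esize e1 + esize e2).+1
  end.

Fixpoint small_consts (e : sexpr) : bool :=
  match e with
  | SConst z => (`|z| <= 4)%N
  | SVar k => (k < K)%N
  | SAdd e1 e2 | SSub e1 e2 | SMul e1 e2 => small_consts e1 && small_consts e2
  end.

Definition fits (e : sexpr) : bool :=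
  [&& small_consts e, (esize e <= K)%N & (deg e <= D)%N].

Fixpoint leveled (c : cmd) : bool :=
  match c with
  | Nop => true
  | Assign k e => [&& fits e, (k < K)%N, (0 < lv k)%N & (deg e <= lv k)%N]
  | Read k j => [&& fits (SVar j), fits (SVar k), (0 < lv k)%N & (la <= lv k)%N]
  | Write j e => [&& fits (SVar j), fits e, (0 < la)%N & (deg e <= la)%N]
  | Then c1 c2 => leveled c1 && leveled c2
  | If e c1 c2 => [&& fits e, leveled c1 & leveled c2]
  | While e c => fits e && leveled c
  end.

(* The initial values are at most [2 ^ L], and each step increases [E] by [K]. *)
Definition bounded (L E : nat) (st : state) : Prop :=
  (forall k, `|(st.1`_k)%R| <= 2 ^ (L * (lv k * E + 1)))%N /\
  (forall i, `|st.2 i| <= 2 ^ (L * (la * E + 1)))%N.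

(** A sum at most doubles the larger bound, which is paid for by the successor in [esize]; in a
    product the exponents add up. As 1 < L, the constants, which are at most 4, are below 2^L. *)
Lemma seval_le L E st e : (1 < L)%N -> bounded L E st -> small_consts e ->
  (`|seval st.1 e| <= 2 ^ (L * (deg e * E + esize e)))%N.
Proof.
move=> L2 [bs _].
have sum_le (x y : int) d1 d2 s1 s2 :
    (`|x| <= 2 ^ (L * (d1 * E + s1)))%N -> (`|y| <= 2 ^ (L * (d2 * E + s2)))%N ->
    (`|x|%N + `|y|%N <= 2 ^ (L * (maxn d1 d2 * E + (s1 + s2).+1)))%N.
  move=> hx hy.
  have le1 : (`|x| <= 2 ^ (L * (maxn d1 d2 * E + (s1 + s2))))%N.
    apply: leq_trans hx _; rewrite leq_pexp2l // leq_mul2l; apply/orP; right.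
    by rewrite leq_add ?leq_addr // leq_mul2r leq_maxl orbT.
  have le2 : (`|y| <= 2 ^ (L * (maxn d1 d2 * E + (s1 + s2))))%N.
    apply: leq_trans hy _; rewrite leq_pexp2l // leq_mul2l; apply/orP; right.
    by rewrite leq_add ?leq_addl // leq_mul2r leq_maxr orbT.
  rewrite addnS mulnS expnD.
  have : (2 ^ 1 <= 2 ^ L)%N by rewrite leq_pexp2l // ltnW.
  by move: le1 le2; set B := (2 ^ _)%N; set C := (2 ^ L)%N; nia.
elim: e => [z|k|e1 IH1 e2 IH2|e1 IH1 e2 IH2|e1 IH1 e2 IH2] /=.
- move=> z4; apply: leq_trans z4 _.
  by rewrite ?mul0n ?add0n muln1; apply: (@leq_pexp2l 2 2).
- by move=> _; apply: bs.
- by case/andP=> /IH1 h1 /IH2 h2; apply: leq_trans (sum_le _ _ _ _ _ _ h1 h2); lia.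
- by case/andP=> /IH1 h1 /IH2 h2; apply: leq_trans (sum_le _ _ _ _ _ _ h1 h2); lia.
case/andP=> /IH1 h1 /IH2 h2; rewrite abszM.
apply: leq_trans (leq_mul h1 h2) _; rewrite -expnD leq_pexp2l // -mulnDr leq_mul2l.
by apply/orP; right; rewrite mulnDl; lia.
Qed.

(** The first summand accounts for the values of fitting expressions, the second for the indices of
    the scalars. *)
Definition bits (L E : nat) : nat := (L * (D * E + K) + K + 1)%N.

Lemma bitsS L E E' : (E <= E')%N -> (bits L E <= bits L E')%N.
Proof. by move=> leE; rewrite !leq_add2r leq_mul2l leq_add2r leq_mul2l leE !orbT. Qed.

Lemma bits_ge L E d s : (d <= D)%N -> (s <= K)%N -> ((L * (d * E + s)).+1 <= bits L E)%N.
Proof.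
move=> dD sK; rewrite /bits [X in (_ <= X)%N]addn1 ltnS; apply: leq_trans (leq_addr _ _).
by rewrite leq_mul2l leq_add ?orbT // leq_mul2r dD orbT.
Qed.

Lemma bitlen_le (z : int) B : (`|z| <= 2 ^ B)%N -> (bitlen z <= B.+1)%N.
Proof.
move=> le_z; rewrite /bitlen ltnS; apply: leq_trans (leq_trunc_log 2 le_z) _.
by rewrite trunc_expnK.
Qed.

Lemma bitlen_var L E k : (k < K)%N -> (bitlen (Negz k) <= bits L E)%N.
Proof.
move=> ltk; rewrite /bitlen /= -ltnS /bits.
have : (trunc_log 2 k.+1 < k.+1)%N.
  by apply: (leq_trans (ltn_expl _ (isT : (1 < 2)%N))); apply: trunc_logP.
lia.
Qed.

Section State.
Variables (L E : nat) (m : memory) (st : state).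
Hypotheses (L2 : (1 < L)%N) (rep : represents m st) (bnd : bounded L E st).
Local Notation B := (bits L E).

Lemma seval_bits e : fits e -> (bitlen (seval st.1 e) <= B)%N.
Proof.
case/and3P=> ce se de; apply: leq_trans (bitlen_le (seval_le L2 bnd ce)) _.
exact: bits_ge.
Qed.

Lemma fitsW e1 e2 e : fits e -> small_consts e = small_consts e1 && small_consts e2 ->
  (esize e1 + esize e2 < esize e)%N -> (maxn (deg e1) (deg e2) <= deg e)%N ->
  fits e1 && fits e2.
Proof. by case/and3P=> ce se de; rewrite ce => /esym/andP[c1 c2]; rewrite /fits c1 c2; lia. Qed.

Lemma expr_cost_le e : fits e -> (expr_cost m (compile_expr e) <= 3 * esize e * B)%N.
Proof.
elim: e => [z|k|e1 IH1 e2 IH2|e1 IH1 e2 IH2|e1 IH1 e2 IH2] fe /=.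
- by have := seval_bits fe; rewrite /=; lia.
- have := seval_bits fe; rewrite /= -(proj1 rep) => h.
  by case/and3P: fe => /(bitlen_var L E); lia.
- have /andP[f1 f2] : fits e1 && fits e2 by apply: (fitsW fe) => //=; lia.
  by rewrite !(eval_compile _ rep); move: (seval_bits f1) (seval_bits f2) (IH1 f1) (IH2 f2); nia.
- have /andP[f1 f2] : fits e1 && fits e2 by apply: (fitsW fe) => //=; lia.
  by rewrite !(eval_compile _ rep); move: (seval_bits f1) (seval_bits f2) (IH1 f1) (IH2 f2); nia.
have /andP[f1 f2] : fits e1 && fits e2 by apply: (fitsW fe) => //=; lia.
by rewrite !(eval_compile _ rep); move: (seval_bits f1) (seval_bits f2) (IH1 f1) (IH2 f2); nia.
Qed.

Lemma expr_cost_leK e : fits e -> (expr_cost m (compile_expr e) <= 3 * K * B)%N.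
Proof.
move=> fe; apply: leq_trans (expr_cost_le fe) _.
by case/and3P: fe => _ se _; rewrite leq_mul2r leq_mul2l se !orbT.
Qed.

End State.

Lemma boundedS L E E' st : (E <= E')%N -> bounded L E st -> bounded L E' st.
Proof.
move=> leE [bs ba]; split=> k; [apply: leq_trans (bs k) _|apply: leq_trans (ba k) _];
by rewrite leq_pexp2l // leq_mul2l leq_add2r leq_mul2l leE !orbT.
Qed.

Lemma bounded_set L E s mu k v : bounded L E (s, mu) -> 
  (`|v| <= 2 ^ (L * (lv k * E + 1)))%N -> bounded L E (set_nth 0 s k v, mu).
Proof.
move=> [bs ba] bv; split=> //= j; rewrite nth_set_nth /=.
by case: eqP => [->|_] //; apply: bs.
Qed.

(** An instruction evaluates an expression of size at most [K], at three lengths per node, and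
    handles a few further numbers, at most nine lengths in all. *)
Definition step_cost L E : nat := ((3 * K + 9) * bits L E)%N.

Lemma step_cost_ge L E E' : (E <= E')%N ->
  (3 * K * bits L E + 9 * bits L E <= step_cost L E')%N.
Proof. by move=> leE; rewrite -mulnDl leq_mul2l bitsS ?orbT. Qed.

(** An expression of degree at most l and size at most K has exponent at most lE + K, up to the
    factor L, and this is at most l(E + K) + 1 when l is positive. Hence adding K to E at each step
    preserves the bounds. An assignment such as squaring a scalar in place would have degree 2l and
    is excluded, so the lengths grow only linearly with the number of steps. *)
Theorem compile_correct L c st s st' : (0 < K)%N -> (1 < L)%N -> cexec c st s st' ->
  leveled c -> forall E m, represents m st -> bounded L E st ->
  exists t m', [/\ exec (compile c) m t m', represents m' st',
    bounded L (E + s * K) st' & (t <= s * step_cost L (E + s * K))%N].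
Proof.
move=> K0 L2.
elim=> {c st s st'} [st|k e s mu|k j i s mu sj|j e i s mu sj
  |c1 c2 st st1 st2 t1 t2 _ IH1 _ IH2|e c1 c2 st st1 t _ IH
  |e c st st1 st2 t1 t2 e0 _ IH1 _ IH2|e c st e0] /=.
- move=> _ E m rm bm; exists 1%N, m; split=> //; first exact: exec_skip.
    by apply: boundedS bm; lia.
  by rewrite mul1n /step_cost /bits; lia.
- case/and4P=> fe kK lk dk E m rm bm; have /and3P[ce se _] := fe.
  have eK := expr_cost_leK L2 rm bm fe; have vB := seval_bits L2 bm fe.
  eexists; exists (update m (Negz k) (seval s e)); split.
  + by have := exec_store m (Const (Negz k)) (compile_expr e); rewrite (eval_compile _ rm); apply.
  + exact: represents_set.
  + apply: bounded_set; first by apply: boundedS bm; lia.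
    apply: leq_trans (seval_le L2 bm ce) _; rewrite leq_pexp2l // leq_mul2l; apply/orP; right.
    nia.
  + have := bitlen_var L E kK; have := step_cost_ge L (leq_addr (1 * K) E).
    by rewrite (mul1n (step_cost _ _)); move: eK vB => /=; lia.
- case/and4P=> fj fk lk lak E m rm bm; have /andP[kK _] := fk; have /andP[jK _] := fj.
  have vj := seval_bits L2 bm fj; have vi : (bitlen (mu i) <= bits L E)%N.
    apply: leq_trans (bitlen_le ((proj2 bm) i)) _;
    by case/and3P: fk => _ _ /= lkD; apply: bits_ge; rewrite ?(leq_trans lak).
  have ej : eval m (compile_expr (SVar j)) = Posz i by rewrite (eval_compile _ rm).
  eexists; exists (update m (Negz k) (mu i)); split.
  + have := exec_store m (Const (Negz k)) (Reg (compile_expr (SVar j))).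
    rewrite (_ : eval m (Reg _) = mu i); last by rewrite /= in ej *; rewrite ej (proj2 rm).
    by apply.
  + exact: represents_set.
  + apply: bounded_set; first by apply: boundedS bm; lia.
    apply: leq_trans ((proj2 bm) i) _; rewrite leq_pexp2l // leq_mul2l; apply/orP; right.
    nia.
  + have := bitlen_var L E kK; have := bitlen_var L E jK; have := step_cost_ge L (leq_addr (1 * K) E).
    have := expr_cost_leK L2 rm bm fj; move: ej vj vi; rewrite /= => ->.
    by rewrite sj (proj2 rm) (mul1n (step_cost _ _)) /=; lia.
- case/and4P=> fj fe la0 dk E m rm bm; have /and3P[ce se _] := fe; have /andP[jK _] := fj.
  have vj := seval_bits L2 bm fj; have vB := seval_bits L2 bm fe.
  have eK := expr_cost_leK L2 rm bm fe.
  have ej : eval m (compile_expr (SVar j)) = Posz i by rewrite (eval_compile _ rm).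
  eexists; exists (update m (Posz i) (seval s e)); split.
  + have := exec_store m (compile_expr (SVar j)) (compile_expr e).
    by rewrite ej (eval_compile _ rm); apply.
  + exact: represents_write.
  + have [bs ba] : bounded L (E + 1 * K) (s, mu) by apply: boundedS bm; lia.
    split=> //= i'; rewrite /upd; case: eqP => _; last exact: ba.
    apply: leq_trans (seval_le L2 bm ce) _; rewrite leq_pexp2l // leq_mul2l; apply/orP; right.
    nia.
  + have := bitlen_var L E jK; have := step_cost_ge L (leq_addr (1 * K) E).
    have := expr_cost_le L2 rm bm fj; move: ej vj vB eK; rewrite /= => ->.
    by rewrite sj (mul1n (step_cost _ _)) /=; lia.
- case/andP=> w1 w2 E m rm bm.
  have [u1 [m1 [x1 r1 b1 l1]]] := IH1 w1 E m rm bm.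
  have [u2 [m2 [x2 r2 b2 l2]]] := IH2 w2 _ m1 r1 b1.
  exists (u1 + u2)%N, m2; split; rewrite ?mulnDl ?addnA //; first exact: exec_seq x1 x2.
  apply: leq_add l2; apply: leq_trans l1 _.
  by rewrite leq_mul2l /step_cost leq_mul2l bitsS ?orbT // leq_addr.
- case/and3P=> fe w1 w2 E m rm bm.
  have wc : leveled (if 0 < seval st.1 e then c1 else c2) by case: ifP.
  have [u [m1 [x1 r1 b1 l1]]] := IH wc E m rm bm.
  exists (expr_cost m (compile_expr e) + bitlen (eval m (compile_expr e)) + u)%N, m1; split=> //.
  + move: x1; case: (ltP 0 (seval st.1 e)) => h x1; [apply: exec_if_true|apply: exec_if_false] => //;
    by rewrite (eval_compile _ rm).
  + by apply: boundedS b1; lia.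
  have eK := expr_cost_leK L2 rm bm fe; have vB := seval_bits L2 bm fe.
  have h1 : (E <= E + t.+1 * K)%N by lia.
  have h2 : (bits L (E + t * K) <= bits L (E + t.+1 * K))%N by apply: bitsS; lia.
  rewrite (eval_compile _ rm) mulSn; apply: leq_add.
    by have := step_cost_ge L h1; lia.
  by apply: leq_trans l1 _; rewrite leq_mul2l /step_cost leq_mul2l h2 !orbT.
- case/andP=> fe wc E m rm bm.
  have [u1 [m1 [x1 r1 b1 l1]]] := IH1 wc E m rm bm.
  have [|u2 [m2 [x2 r2 b2 l2]]] := IH2 _ _ m1 r1 b1; first exact/andP.
  exists (expr_cost m (compile_expr e) + bitlen (eval m (compile_expr e)) + u1 + u2)%N, m2; split=> //.
  + by apply: exec_while_true x1 x2; rewrite (eval_compile _ rm).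
  + by apply: boundedS b2; lia.
  have eK := expr_cost_leK L2 rm bm fe; have vB := seval_bits L2 bm fe.
  have h0 : (E <= E + (t1 + t2).+1 * K)%N by lia.
  have h1 : (bits L (E + t1 * K) <= bits L (E + (t1 + t2).+1 * K))%N by apply: bitsS; lia.
  have h2 : (bits L (E + t1 * K + t2 * K) <= bits L (E + (t1 + t2).+1 * K))%N by apply: bitsS; lia.
  have l1' : (u1 <= t1 * step_cost L (E + (t1 + t2).+1 * K))%N.
    by apply: leq_trans l1 _; rewrite leq_mul2l /step_cost leq_mul2l h1 !orbT.
  have l2' : (u2 <= t2 * step_cost L (E + (t1 + t2).+1 * K))%N.
    by apply: leq_trans l2 _; rewrite leq_mul2l /step_cost leq_mul2l h2 !orbT.
  rewrite (eval_compile _ rm) mulSn mulnDl.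
  by have := step_cost_ge L h0; lia.
case/andP=> fe wc E m rm bm.
exists (expr_cost m (compile_expr e) + bitlen (eval m (compile_expr e)))%N, m; split=> //.
+ by apply: exec_while_false; rewrite (eval_compile _ rm).
+ by apply: boundedS bm; lia.
have eK := expr_cost_leK L2 rm bm fe; have vB := seval_bits L2 bm fe.
have := step_cost_ge L (leq_addr (1 * K) E).
by rewrite (eval_compile _ rm) (mul1n (step_cost _ _)); lia.
Qed.

End Cost.

(** * Weakest preconditions *)

Definition wp (c : cmd) (Q : nat -> state -> Prop) (st : state) : Prop :=
  exists s st', cexec c st s st' /\ Q s st'.

Lemma wp_nop (Q : nat -> state -> Prop) st : Q 1%N st -> wp Nop Q st.
Proof. by move=> q; exists 1%N, st; split=> //; constructor. Qed.

Lemma wp_set k e (Q : nat -> state -> Prop) s mu :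
  Q 1%N (set_nth 0 s k (seval s e), mu) -> wp (Assign k e) Q (s, mu).
Proof. by move=> q; do 2 eexists; split; last exact: q; constructor. Qed.

Lemma wp_read k j i (Q : nat -> state -> Prop) s mu : s`_j = Posz i ->
  Q 1%N (set_nth 0 s k (mu i), mu) -> wp (Read k j) Q (s, mu).
Proof. by move=> sj q; do 2 eexists; split; last exact: q; constructor. Qed.

Lemma wp_write j e i (Q : nat -> state -> Prop) s mu : s`_j = Posz i ->
  Q 1%N (s, upd mu i (seval s e)) -> wp (Write j e) Q (s, mu).
Proof. by move=> sj q; do 2 eexists; split; last exact: q; constructor. Qed.

Lemma wp_then c1 c2 (Q : nat -> state -> Prop) st :
  wp c1 (fun s1 => wp c2 (fun s2 => Q (s1 + s2)%N)) st -> wp (Then c1 c2) Q st.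
Proof.
case=> s1 [st1 [x1 [s2 [st2 [x2 q]]]]].
by exists (s1 + s2)%N, st2; split=> //; apply: cexec_then x1 x2.
Qed.

Lemma wp_if e c1 c2 (Q : nat -> state -> Prop) st :
  wp (if 0 < seval st.1 e then c1 else c2) (fun s => Q s.+1) st -> wp (If e c1 c2) Q st.
Proof.
by case=> s [st1 [x q]]; exists s.+1, st1; split=> //; constructor.
Qed.

Lemma wp_while_true e c (Q : nat -> state -> Prop) st : 0 < seval st.1 e ->
  wp c (fun s1 => wp (While e c) (fun s2 => Q (s1 + s2).+1%N)) st -> wp (While e c) Q st.
Proof.
move=> e0 [s1 [st1 [x1 [s2 [st2 [x2 q]]]]]].
by exists (s1 + s2).+1%N, st2; split=> //; apply: cexec_while_true x1 x2.
Qed.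

Lemma wp_while_false e c (Q : nat -> state -> Prop) st : seval st.1 e <= 0 ->
  Q 1%N st -> wp (While e c) Q st.
Proof. by move=> e0 q; exists 1%N, st; split=> //; constructor. Qed.

Declare Scope cmd_scope.
Delimit Scope cmd_scope with cmd.
Local Notation "'$' k" := (SVar k) (at level 2, format "'$' k") : cmd_scope.
Local Notation "x + y" := (SAdd x y) : cmd_scope.
Local Notation "x - y" := (SSub x y) : cmd_scope.
Local Notation "x * y" := (SMul x y) : cmd_scope.
Local Notation "'%' z" := (SConst (Posz z)) (at level 2) : cmd_scope.
Local Notation "k '::=' e" := (Assign k e%cmd) (at level 75) : cmd_scope.
Local Notation "c ;; d" := (Then c d) (at level 80, right associativity) : cmd_scope.

Ltac step := apply: wp_then; apply: wp_set => /=.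

(** * Rounding division *)

Definition div_scale : cmd :=
  While ($4 - $3 + %1)%cmd (3 ::= $3 + $3;; 5 ::= $5 + %1)%cmd.

Definition div_digits : cmd :=
  While ($5)%cmd
   (5 ::= $5 - %1;; 4 ::= $4 + $4;; 2 ::= $2 + $2;;
    If ($4 - $3 + %1)%cmd (4 ::= $4 - $3;; 2 ::= $2 + %1) Nop)%cmd.

(* Scalar 2 becomes the quotient of [a], in scalar 0, by [b], in scalar 1, rounded
   to the nearest integer; for [a >= 0] this is the floor of (2a + b) / (2b).  As
   numbers cannot be halved, the remainder is doubled at each digit instead of
   halving the divisor. *)
Definition rdiv : cmd :=
  (If $0 (4 ::= $0 + $0 + $1) (4 ::= $1 - $0 - $0);;
   3 ::= $1 + $1;; 5 ::= %0;; div_scale;; 2 ::= %0;; div_digits;;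
   If $0 Nop (2 ::= %0 - $2))%cmd.

(** [n] only bounds the number of doublings; the actual number [j] is left in scalar 5 for
    [div_digits]. *)
Lemma wp_div_scale a b q z rest mu (d : int) (n k : nat) (Q : nat -> state -> Prop) :
  z < d * 2 ^+ n ->
  (forall s j, (s <= 3 * n + 1)%N -> (j <= n)%N -> z < d * 2 ^+ j ->
    Q s ([:: a, b, q, d * 2 ^+ j, z, Posz (k + j) & rest], mu)) ->
  wp div_scale Q ([:: a, b, q, d, z, Posz k & rest], mu).
Proof.
elim: n d k Q => [|n IHn] d k Q zd qQ.
  apply: wp_while_false => /=; first by lia.
  by have := qQ 1%N 0%N; rewrite expr0 mulr1 addn0; apply=> //; rewrite expr0 mulr1 in zd.
have [lt_zd|le_dz] := ltP z d.
  apply: wp_while_false => /=; first by lia.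
  by have := qQ 1%N 0%N; rewrite expr0 mulr1 addn0; apply=> //; lia.
apply: wp_while_true => /=; first by lia.
step; apply: wp_set => /=.
have -> : Posz k + 1 = Posz k.+1 by lia.
have dd : d + d = d * 2 by lia.
rewrite dd; apply: IHn => [|s j ls lj zj]; first by rewrite -mulrA -exprS.
have := qQ (1 + 1 + s).+1%N j.+1; rewrite exprS mulrA (addSnnS k j); apply=> //; lia.
Qed.

(** Each round doubles [q * d + z], and at most one subtraction of [d] brings the remainder back
    into range. With [d] equal to 2b times 2^n, and [q] initially 0, the final quotient is that of
    [z] by 2b. *)
Lemma wp_div_digits a b d rest mu (n : nat) q z (Q : nat -> state -> Prop) :
  0 <= z < d ->
  (forall s q' z', (s <= 8 * n + 1)%N -> 0 <= z' < d ->
     q' * d + z' = 2 ^+ n * (q * d + z) ->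
     Q s ([:: a, b, q', d, z', 0 & rest], mu)) ->
  wp div_digits Q ([:: a, b, q, d, z, Posz n & rest], mu).
Proof.
elim: n q z Q => [|n IHn] q z Q zd qQ.
  by apply: wp_while_false => //=; apply: qQ => //; rewrite expr0 mul1r.
apply: wp_while_true => //=.
step; step; step.
have -> : Posz n.+1 - 1 = Posz n by lia.
apply: wp_if => /=; case: ifP => hz.
  step; apply: wp_set => /=; apply: IHn => [|s q' z' ls hz' eq']; first by lia.
  by apply: qQ => //; [lia|rewrite eq' exprS; ring].
apply: wp_nop; apply: IHn => [|s q' z' ls hz' eq']; first by lia.
by apply: qQ => //; [lia|rewrite eq' exprS; ring].
Qed.

Lemma euclid_uniq (q q' r r' d : int) :
  0 <= r < d -> 0 <= r' < d -> q * d + r = q' * d + r' -> q = q'.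
Proof.
move=> hr hr' e; have d0 : d != 0 by lia.
have := congr1 (fun x => divz x d) e => /=.
by rewrite !divzMDl // !divz_small ?addr0 // /intdiv.divz; lia.
Qed.

Lemma wp_rdiv a b q c rest mu L (q0 d0 z0 k0 : int) (Q : nat -> state -> Prop) :
  a = q * b + c -> 2 * `|c| < b -> `|a| <= 2 ^+ L ->
  (forall s d z, (s <= 11 * L + 40)%N -> Q s ([:: a, b, q, d, z, 0 & rest], mu)) ->
  wp rdiv Q ([:: a, b, q0, d0, z0, k0 & rest], mu).
Proof.
move=> ea bc aL qQ.
have b0 : 0 < b by lia.
pose w := if 0 < a then a + a + b else b - a - a.
have w0 : 0 <= w by rewrite /w; case: ifP; lia.
(* As w is at most 2|a| + b and b is positive, L + 2 doublings of 2b suffice. *)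
have wL : w < (b + b) * 2 ^+ L.+2.
  have wb : w <= 2 * `|a| + b by rewrite /w; case: ifP; lia.
  have : (1 : int) <= 2 ^+ L by rewrite exprn_ege1.
  by rewrite 2!exprS; move: (2 ^+ L) aL => B; nia.
rewrite /rdiv; apply: wp_then; apply: wp_if.
have -> : (if 0 < seval ([:: a, b, q0, d0, z0, k0 & rest], mu).1 (SVar 0)
             then (4 ::= $0 + $0 + $1)%cmd else (4 ::= $1 - $0 - $0)%cmd) =
          Assign 4 (if 0 < a then ($0 + $0 + $1)%cmd else ($1 - $0 - $0)%cmd).
  by move=> /=; case: ifP.
apply: wp_set => /=.
rewrite (_ : seval _ _ = w); last by rewrite /w; case: ifP.
step; step; apply: wp_then; apply: wp_div_scale wL _ => s1 j ls1 lj wj.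
rewrite add0n; step; apply: wp_then; apply: wp_div_digits => [|s2 q' z' ls2 hz' e']; first by lia.
have eq' : q' = if 0 < a then q else - q.
  have P0 : (0 : int) < 2 ^+ j by rewrite exprn_gt0.
  (* The remainder of 2a + b, or of b - 2a, modulo 2b: it lies strictly between 0 and 2b because
     2|c| < b. The quotient is [q] or [- q] respectively. *)
  pose e := if 0 < a then b + 2 * c else b - 2 * c.
  apply: (@euclid_uniq _ _ z' (2 ^+ j * e) ((b + b) * 2 ^+ j)) => //.
    by rewrite /e; case: ifP => _; nia.
  rewrite e' mul0r add0r /e /w; case: ifP => _; rewrite ea; ring.
apply: wp_if => /=; case: ifP eq' => ha ->.
  by apply: wp_nop; apply: qQ; lia.
apply: wp_set => /=; rewrite sub0r opprK; apply: qQ; lia.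
Qed.

(** * Digits in a balanced base *)

Definition balanced (B : int) (cs : seq int) : bool := all (fun c => 2 * `|c| < B) cs.

Lemma horner_rec_balanced_lt B cs : 1 < B -> balanced B cs ->
  2 * `|horner_rec cs B| < B ^+ size cs.
Proof.
move=> B1; elim: cs => [|c cs IHcs] //= /andP[hc /IHcs].
rewrite exprS; move: (horner_rec cs B) (B ^+ _) => x y h; nia.
Qed.

(** The lowest digit is less than B in absolute value, so a vanishing value forces the higher part
    to vanish, and induction leaves a single zero digit, contrary to the condition on the last one.
    The default 1 lets the empty list pass. Hence a loop that runs while the number is nonzero
    extracts exactly the digits. *)
Lemma horner_rec_balanced0 B cs : balanced B cs -> last 1 cs != 0 ->
  horner_rec cs B = 0 -> cs = [::].
Proof.
elim: cs => [|c cs IHcs] //= /andP[hc bcs] lcs e.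
have h0 : horner_rec cs B = 0 by move: (horner_rec cs B) e => x; nia.
have ecs : cs = [::] by apply: IHcs => //; case: (cs) lcs.
by move: e lcs; rewrite h0 ecs /= mul0r add0r => ->; rewrite eqxx.
Qed.

(** Keeps the size bound that [wp_rdiv] requires as digits are split off. *)
Lemma horner_rec_balanced_quo B c cs : balanced B (c :: cs) ->
  `|horner_rec cs B| <= `|horner_rec (c :: cs) B|.
Proof. by case/andP=> hc _ /=; move: (horner_rec cs B) => x; nia. Qed.

Lemma last_cons_neq0 (c : int) cs : last 1 (c :: cs) != 0 -> last 1 cs != 0.
Proof. by case: cs. Qed.

Definition segment (mu : nat -> int) (i : nat) (w : seq int) : Prop :=
  forall k, (k < size w)%N -> mu (i + k)%N = w`_k.

Lemma segment_cons mu i c w : segment mu i (c :: w) <-> mu i = c /\ segment mu i.+1 w.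
Proof.
split=> [h|[<- h] [|k]]; last by rewrite addnS -addSn; apply: h.
  split=> [|k lk]; first by have := h 0%N; rewrite addn0; apply.
  by have := h k.+1; rewrite addnS -addSn; apply.
by rewrite addn0.
Qed.

Lemma segment_cat mu i w1 w2 :
  segment mu i (w1 ++ w2) <-> segment mu i w1 /\ segment mu (i + size w1)%N w2.
Proof.
elim: w1 i => [|c w1 IHw] i /=; first by rewrite addn0; split=> [|[]].
by rewrite !segment_cons IHw addnS addSn; tauto.
Qed.

(** * Evaluation of an encoded polynomial *)

(** Scalar 0 is the read address, scalar 2 counts the coefficients left in the row, scalar 4 is the
    value of the current monomial, and scalar 6 accumulates the sum. *)
Definition row_loop : cmd :=
  While ($2)%cmd
    (2 ::= $2 - %1;; Read 5 0;; 6 ::= $6 + $5 * $4;; 4 ::= $4 * $8;; 0 ::= $0 + %1)%cmd.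

Definition rows_loop : cmd :=
  While ($1)%cmd
    (1 ::= $1 - %1;; Read 2 0;; 0 ::= $0 + %1;; 4 ::= $3;; row_loop;; 3 ::= $3 * $7)%cmd.

(* Evaluates the polynomial encoded from the cell in scalar 0 on, at the
   scalars 7 and 8, into scalar 6. *)
Definition eval_poly2 : cmd :=
  (Read 1 0;; 0 ::= $0 + %1;; 6 ::= %0;; 3 ::= %1;; rows_loop)%cmd.

Lemma wp_row_loop (q : seq int) mu i (s px py cf dst x y : int) rest (Q : nat -> state -> Prop) :
  segment mu i q ->
  (forall t py' cf', (t <= 6 * size q + 1)%N ->
    Q t ([:: Posz (i + size q)%N, s, 0, px, py', cf', dst + py * horner_rec q y, x, y & rest], mu)) ->
  wp row_loop Q ([:: Posz i, s, Posz (size q), px, py, cf, dst, x, y & rest], mu).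
Proof.
elim: q i py cf dst Q => [|c q IHq] i py cf dst Q /=.
  move=> _ qQ; apply: wp_while_false => //=.
  by have := qQ 1%N py cf; rewrite mulr0 addr0 addn0; apply.
case/segment_cons=> mui hseg qQ; apply: wp_while_true => //=.
step; apply: wp_then; apply: (@wp_read _ _ i) => //=.
step; step; apply: wp_set => /=.
have -> : Posz (size q).+1 - 1 = Posz (size q) by lia.
have -> : Posz i + 1 = Posz i.+1 by lia.
apply: IHq => // t py' cf' lt.
have := qQ (1 + (1 + (1 + (1 + 1))) + t).+1%N py' cf'.
rewrite mui -(addSnnS i) (_ : _ + _ + _ = dst + py * (horner_rec q y * y + c)); last by ring.
by apply; lia.
Qed.

Lemma wp_rows_loop (ps : seq {poly int}) mu i (s2 px py cf dst x y : int) rest N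
    (Q : nat -> state -> Prop) :
  segment mu i (flatten [seq encode_poly q | q : {poly int} <- ps]) ->
  {in ps, forall q : {poly int}, (size q <= N)%N} ->
  (forall t r2 r3 r4 r5, (t <= size ps * (6 * N + 8) + 1)%N ->
    Q t ([:: Posz (i + size (flatten [seq encode_poly q | q : {poly int} <- ps]))%N, 0, r2, r3, r4, r5,
      dst + px * horner_rec [seq q.[y] | q : {poly int} <- ps] x, x, y & rest], mu)) ->
  wp rows_loop Q ([:: Posz i, Posz (size ps), s2, px, py, cf, dst, x, y & rest], mu).
Proof.
elim: ps i s2 px py cf dst Q => [|q ps IHps] i s2 px py cf dst Q /=.
  move=> _ _ qQ; apply: wp_while_false => //=.
  by have := qQ 1%N s2 px py cf; rewrite mulr0 addr0 addn0; apply.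
rewrite segment_cons segment_cat => -[mui [hq hps]] leN qQ.
have sq : (size q <= N)%N by apply: leN; rewrite inE eqxx.
apply: wp_while_true => //=.
step; apply: wp_then; apply: (@wp_read _ _ i) => //=.
step; step.
have -> : Posz (size ps).+1 - 1 = Posz (size ps) by lia.
have -> : Posz i + 1 = Posz i.+1 by lia.
rewrite mui; apply: wp_then; apply: wp_row_loop => // t py' cf' lt.
apply: wp_set => /=; apply: IHps => //.
  by move=> q' q'ps; apply: leN; rewrite inE q'ps orbT.
move=> t' r2 r3 r4 r5 lt'.
have := qQ (1 + (1 + (1 + (1 + (t + 1)))) + t').+1%N r2 r3 r4 r5.
rewrite size_cat -(addSnnS i) (addnA i.+1).
rewrite (_ : _ + _ * (_ * _ + _) = dst + px * horner_rec q y +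
  px * x * horner_rec [seq q0.[y] | q0 : {poly int} <- ps] x); last first.
  by rewrite -[q.[y]]/(horner_rec q y); ring.
by apply; move: lt lt' sq; move: (size q) (size ps) => a b; lia.
Qed.

Lemma horner_rec_map (R : nzRingType) (S : Type) (f : S -> R) (x0 : S) (s : seq S) x :
  horner_rec (map f s) x = \sum_(i < size s) f (nth x0 s i) * x ^+ i.
Proof.
elim: s => [|a s IHs] /=; first by rewrite big_ord0.
rewrite big_ord_recl expr0 mulr1 addrC IHs big_distrl; congr (_ + _).
by apply: eq_bigr => i _; rewrite /= -mulrA -exprSr.
Qed.

Lemma horner2E (p : {poly {poly int}}) (x y : int) :
  horner_rec [seq q.[y] | q : {poly int} <- p] x = p.[x%:P].[y].
Proof.
rewrite (horner_rec_map _ 0) (horner_coef p) horner_sum; apply: eq_bigr => i _.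
by rewrite hornerM horner_exp hornerC.
Qed.

Lemma wp_eval_poly2 (p : {poly {poly int}}) mu i (r1 r2 r3 r4 r5 r6 x y : int) rest N
    (Q : nat -> state -> Prop) :
  segment mu i (encode_poly2 p) ->
  {in p : seq {poly int}, forall q : {poly int}, (size q <= N)%N} ->
  (forall t r2 r3 r4 r5, (t <= size p * (6 * N + 8) + 5)%N ->
    Q t ([:: Posz (i + size (encode_poly2 p))%N, 0, r2, r3, r4, r5, p.[x%:P].[y], x, y & rest], mu)) ->
  wp eval_poly2 Q ([:: Posz i, r1, r2, r3, r4, r5, r6, x, y & rest], mu).
Proof.
rewrite segment_cons => -[mui hp] leN qQ.
apply: wp_then; apply: (@wp_read _ _ i) => //=.
step; step; step.
have -> : Posz i + 1 = Posz i.+1 by lia.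
rewrite mui; apply: wp_rows_loop hp leN _ => t r2' r3' r4' r5' lt.
have := qQ (1 + (1 + (1 + (1 + t))))%N r2' r3' r4' r5'.
by rewrite add0r mul1r horner2E /= -(addSnnS i); apply; lia.
Qed.

(** * The sum over pairs of digits *)

(* In scalars 10, 11 and 12 are y, x and the base w of the two packed numbers in
   scalars 13 and 14, the digits of which are indexed by scalars 16 and 17.  The
   sum is accumulated in scalar 15. *)
Definition power_loop (b : sexpr) : cmd :=
  While ($19)%cmd (19 ::= $19 - %1;; 18 ::= $18 * b)%cmd.

(** Loops test for positivity only; the square tests whether a number of either sign is nonzero. *)
Definition digits_loop : cmd :=
  While ($6 * $6)%cmd
   (0 ::= $6;; 1 ::= $12;; rdiv;; 8 ::= $6 - $2 * $12;; 6 ::= $2;;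
    18 ::= $7 * $8;; 19 ::= $16 - $17;; power_loop ($11 - %1);;
    19 ::= $17 - $16;; power_loop ($10 - %1);; 15 ::= $15 + $18;; 17 ::= $17 + %1)%cmd.

Definition combine : cmd :=
  (15 ::= %0;; 16 ::= %0;;
   While ($13 * $13)
    (0 ::= $13;; 1 ::= $12;; rdiv;; 7 ::= $13 - $2 * $12;; 13 ::= $2;;
     6 ::= $14;; 17 ::= %0;; digits_loop;; 16 ::= $16 + %1))%cmd.

(** The counter starts at the integer difference, and a negative one ends the loop at once: this
    realises the truncated subtraction. *)
Lemma wp_power_loop b B (r0 r1 r2 r3 r4 r5 r6 r7 r8 r9 r10 r11 r12 r13 r14 r15 r16 r17 p : int)
    (i j : nat) mu (Q : nat -> state -> Prop) :
  (forall p e, seval [:: r0; r1; r2; r3; r4; r5; r6; r7; r8; r9; r10; r11; r12; r13; r14; r15; r16; r17; p; e] b = B) ->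
  (forall t e, (t <= 3 * i + 1)%N ->
    Q t ([:: r0; r1; r2; r3; r4; r5; r6; r7; r8; r9; r10; r11; r12; r13; r14; r15; r16; r17;
      p * B ^+ (i - j); e], mu)) ->
  wp (power_loop b) Q ([:: r0; r1; r2; r3; r4; r5; r6; r7; r8; r9; r10; r11; r12; r13; r14; r15; r16; r17;
      p; Posz i - Posz j], mu).
Proof.
move=> bB; elim: i p Q => [|i IHi] p Q qQ.
  apply: wp_while_false => /=; first by lia.
  by have := qQ 1%N; rewrite sub0n expr0 mulr1; apply.
have [le_ij|lt_ji] := leqP i.+1 j.
  apply: wp_while_false => /=; first by lia.
  have := qQ 1%N; rewrite (_ : (i.+1 - j = 0)%N) ?expr0 ?mulr1; [|lia].
  by apply; lia.
apply: wp_while_true => /=; first by lia.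
step; apply: wp_set => /=; rewrite bB.
have -> : Posz i.+1 - Posz j - 1 = Posz i - Posz j by lia.
apply: IHi => t e lt; rewrite -mulrA -exprS -subSn; last by lia.
by apply: qQ; lia.
Qed.

Lemma wp_digits_loop ds C mu L N (i j : nat)
    (r0 r1 r2 r3 r4 r5 r8 r9 Y X W r13 r14 T r18 r19 : int) (Q : nat -> state -> Prop) :
  balanced W ds -> last 1 ds != 0 -> `|horner_rec ds W| <= 2 ^+ L ->
  (i <= N)%N -> (j + size ds <= N)%N ->
  (forall t r0 r1 r2 r3 r4 r5 r8 r18 r19, (t <= size ds * (11 * L + 6 * N + 60) + 1)%N ->
     Q t ([:: r0; r1; r2; r3; r4; r5; 0; C; r8; r9; Y; X; W; r13; r14;
       T + C * \sum_(k < size ds) ds`_k * ((X - 1) ^+ (i - (j + k)) * (Y - 1) ^+ (j + k - i));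
       Posz i; Posz (j + size ds)%N; r18; r19], mu)) ->
  wp digits_loop Q ([:: r0; r1; r2; r3; r4; r5; horner_rec ds W; C; r8; r9; Y; X; W; r13; r14;
       T; Posz i; Posz j; r18; r19], mu).
Proof.
elim: ds j r0 r1 r2 r3 r4 r5 r8 T r18 r19 Q => [|c ds IHds] j r0 r1 r2 r3 r4 r5 r8 T r18 r19 Q.
  move=> _ _ _ _ _ qQ; apply: wp_while_false => //=.
  by have := qQ 1%N r0 r1 r2 r3 r4 r5 r8 r18 r19; rewrite big_ord0 mulr0 addr0 addn0; apply.
move=> bal lst leL iN jN qQ.
have nz : horner_rec (c :: ds) W != 0 by apply/eqP=> /(horner_rec_balanced0 bal lst).
have leL' := le_trans (horner_rec_balanced_quo bal) leL.
have /andP[hc bal'] := bal; have lst' := last_cons_neq0 lst.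
apply: wp_while_true.
  by rewrite -[_ < _]/(0 < horner_rec (c :: ds) W * horner_rec (c :: ds) W); lia.
set z := horner_rec _ _ in nz leL *.
step; step; apply: wp_then; apply: (@wp_rdiv _ _ (horner_rec ds W) c _ _ L) => // t1 d1 z1 lt1.
step; step; step; step.
rewrite (_ : z - _ = c); last by rewrite /z /=; ring.
apply: wp_then; apply: (@wp_power_loop _ (X - 1)) => // t2 e2 lt2.
step; apply: wp_then; apply: (@wp_power_loop _ (Y - 1)) => // t3 e3 lt3.
step; apply: wp_set => /=.
have -> : Posz j + 1 = Posz j.+1 by lia.
rewrite /= in jN; apply: IHds => //; first by rewrite addSnnS.
move=> t4 *; set t := (X in Q X _).
have lt : (t <= size (c :: ds) * (11 * L + 6 * N + 60) + 1)%N by rewrite /t /=; lia.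
have := qQ t; rewrite [size (_ :: _)]/= big_ord_recl /= addn0 -(addSnnS j (size ds)).
rewrite mulrDr addrA !mulrA => /(_ _ _ _ _ _ _ _ _ _ lt).
under eq_bigr do rewrite /bump /= add1n addnS -addSn.
by apply.
Qed.

Lemma wp_combine cs ds mu L N
    (r0 r1 r2 r3 r4 r5 r6 r7 r8 r9 Y X W r15 r16 r17 r18 r19 : int) (Q : nat -> state -> Prop) :
  balanced W cs -> last 1 cs != 0 -> `|horner_rec cs W| <= 2 ^+ L -> (size cs <= N)%N ->
  balanced W ds -> last 1 ds != 0 -> `|horner_rec ds W| <= 2 ^+ L -> (size ds <= N)%N ->
  (forall t r0 r1 r2 r3 r4 r5 r6 r7 r8 r13 r16 r17 r18 r19,
     (t <= N * (N * (11 * L + 6 * N + 60) + 11 * L + 60) + 3)%N ->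
     Q t ([:: r0; r1; r2; r3; r4; r5; r6; r7; r8; r9; Y; X; W; r13; horner_rec ds W;
       \sum_(i < size cs) cs`_i *
         (\sum_(k < size ds) ds`_k * ((X - 1) ^+ (i - k) * (Y - 1) ^+ (k - i)));
       r16; r17; r18; r19], mu)) ->
  wp combine Q ([:: r0; r1; r2; r3; r4; r5; r6; r7; r8; r9; Y; X; W; horner_rec cs W; horner_rec ds W;
       r15; r16; r17; r18; r19], mu).
Proof.
move=> bal lst leL csN bald lstd leLd dsN qQ; rewrite /combine; step; step.
pose G i := \sum_(k < size ds) ds`_k * ((X - 1) ^+ (i - k) * (Y - 1) ^+ (k - i)).
set loop := While _ _.
(* Generalised for the induction: [css] are the digits left, [i] is the index of the first of them,
   [T] the sum so far and [t0] the number of steps already spent. *)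
suff H n i T t0 a0 a1 a2 a3 a4 a5 a6 a7 a8 a17 a18 a19 css :
    balanced W css -> last 1 css != 0 -> `|horner_rec css W| <= 2 ^+ L -> size css = n ->
    (i + n <= N)%N ->
    (forall t r0 r1 r2 r3 r4 r5 r6 r7 r8 r13 r16 r17 r18 r19,
      (t <= n * (N * (11 * L + 6 * N + 60) + 11 * L + 60) + 1)%N ->
      Q (t0 + t)%N ([:: r0; r1; r2; r3; r4; r5; r6; r7; r8; r9; Y; X; W; r13; horner_rec ds W;
         T + \sum_(k < size css) css`_k * G (i + k)%N; r16; r17; r18; r19], mu)) ->
    wp loop (fun t => Q (t0 + t)%N)
      ([:: a0; a1; a2; a3; a4; a5; a6; a7; a8; r9; Y; X; W; horner_rec css W; horner_rec ds W;
         T; Posz i; a17; a18; a19], mu).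
  apply: (H (size cs) 0%N 0 2%N) => // t *; rewrite add0r.
  under eq_bigr do rewrite add0n.
  by apply: qQ; nia.
elim: n i T t0 a0 a1 a2 a3 a4 a5 a6 a7 a8 a17 a18 a19 css {bal lst leL csN} =>
  [|n IHn] i T t0 a0 a1 a2 a3 a4 a5 a6 a7 a8 a17 a18 a19 [|c css] // bal lst leL sz iN H.
  apply: wp_while_false => //=.
  have := H 1%N a0 a1 a2 a3 a4 a5 a6 a7 a8 0 (Posz i) a17 a18 a19.
  by rewrite big_ord0 addr0; apply; lia.
case: sz => sz.
have nz : horner_rec (c :: css) W != 0 by apply/eqP=> /(horner_rec_balanced0 bal lst).
have leL' := le_trans (horner_rec_balanced_quo bal) leL.
have /andP[hc bal'] := bal; have lst' := last_cons_neq0 lst.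
apply: wp_while_true.
  by rewrite -[_ < _]/(0 < horner_rec (c :: css) W * horner_rec (c :: css) W); lia.
set z := horner_rec _ _ in nz leL *.
step; step; apply: wp_then; apply: (@wp_rdiv _ _ (horner_rec css W) c _ _ L) => // t1 d1 z1 lt1.
step; step; step; step.
rewrite (_ : z - _ = c); last by rewrite /z /=; ring.
apply: wp_then; apply: (@wp_digits_loop _ _ _ L N) => //; first by lia.
move=> t2 b0 b1 b2 b3 b4 b5 b8 b18 b19 lt2; apply: wp_set => /=.
have -> : Posz i + 1 = Posz i.+1 by lia.
set u := (X in wp _ (fun s2 => Q (_ + (X + s2).+1)%N)).
have lu : (u <= N * (11 * L + 6 * N + 60) + 11 * L + 55)%N.
  have : (size ds * (11 * L + 6 * N + 60) <= N * (11 * L + 6 * N + 60))%N by rewrite leq_mul2r dsN orbT.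
  by rewrite /u; lia.
suff : wp loop (fun t => Q ((t0 + u.+1) + t)%N)
    ([:: b0; b1; b2; b3; b4; b5; 0; c; b8; r9; Y; X; W; horner_rec css W; horner_rec ds W;
      T + c * G i; Posz i.+1; Posz (size ds); b18; b19], mu).
  case=> s' [st' [x' q']]; exists s', st'; split; last by move: q'; rewrite -addnA (addSn u).
  by move: x'; rewrite /G.
apply: IHn => //; first by lia.
move=> t *; rewrite -addnA.
have lt : (u.+1 + t <= n.+1 * (N * (11 * L + 6 * N + 60) + 11 * L + 60) + 1)%N by lia.
have := H (u.+1 + t)%N; rewrite [size (_ :: _)]/= big_ord_recl /= addn0 addrA.
move=> /(_ _ _ _ _ _ _ _ _ _ _ _ _ _ _ lt).
under eq_bigr do rewrite /bump /= add1n addnS -addSn.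
by apply.
Qed.

(** * Output of the digits *)

Definition write_row : cmd :=
  While ($17 * $17)%cmd
   (0 ::= $17;; 1 ::= $10;; rdiv;; Write 6 ($17 - $2 * $10);; 17 ::= $2;;
    6 ::= $6 + %1;; 8 ::= $8 + %1)%cmd.

(** A length is known only after the digits have been extracted. Scalar 7 remembers the cell
    reserved for the length of the row, and cell 0 is kept for the number of rows, counted in scalar
    16. *)
Definition write_poly2 : cmd :=
  (6 ::= %1;; 16 ::= %0;;
   While ($15 * $15)
    (0 ::= $15;; 1 ::= $11;; rdiv;; 17 ::= $15 - $2 * $11;; 15 ::= $2;;
     16 ::= $16 + %1;; 7 ::= $6;; 6 ::= $6 + %1;; 8 ::= %0;; write_row;; Write 7 $8);;
   6 ::= %0;; Write 6 $16)%cmd.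

Lemma segment_eq mu mu' i w : (forall k, (i <= k < i + size w)%N -> mu' k = mu k) ->
  segment mu i w -> segment mu' i w.
Proof. by move=> e h k lk; rewrite e ?h //; lia. Qed.

Lemma wp_write_row q mu L (i l : nat)
    (r0 r1 r2 r3 r4 r5 r7 r9 Y r11 r12 r13 r14 r15 r16 r18 r19 : int) (Q : nat -> state -> Prop) :
  balanced Y q -> last 1 q != 0 -> `|horner_rec q Y| <= 2 ^+ L ->
  (forall t r0 r1 r2 r3 r4 r5 mu', (t <= size q * (11 * L + 60) + 1)%N ->
     (forall k, (k < i)%N -> mu' k = mu k) -> segment mu' i q ->
     Q t ([:: r0; r1; r2; r3; r4; r5; Posz (i + size q)%N; r7; Posz (l + size q)%N; r9; Y; r11; r12; r13; r14;
       r15; r16; 0; r18; r19], mu')) ->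
  wp write_row Q ([:: r0; r1; r2; r3; r4; r5; Posz i; r7; Posz l; r9; Y; r11; r12; r13; r14;
       r15; r16; horner_rec q Y; r18; r19], mu).
Proof.
elim: q mu i l r0 r1 r2 r3 r4 r5 Q => [|c q IHq] mu i l r0 r1 r2 r3 r4 r5 Q bal lst leL qQ.
  apply: wp_while_false => //=.
  have := qQ 1%N r0 r1 r2 r3 r4 r5 mu; rewrite !addn0; apply=> //.
have nz : horner_rec (c :: q) Y != 0 by apply/eqP=> /(horner_rec_balanced0 bal lst).
have leL' := le_trans (horner_rec_balanced_quo bal) leL.
have /andP[hc bal'] := bal; have lst' := last_cons_neq0 lst.
apply: wp_while_true.
  by rewrite -[_ < _]/(0 < horner_rec (c :: q) Y * horner_rec (c :: q) Y); lia.
set z := horner_rec _ _ in nz leL *.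
step; step; apply: wp_then; apply: (@wp_rdiv _ _ (horner_rec q Y) c _ _ L) => // t1 d1 z1 lt1.
apply: wp_then; apply: (@wp_write _ _ i) => //=.
rewrite (_ : z - _ = c); last by rewrite /z /=; ring.
step; step; apply: wp_set => /=.
have -> : Posz i + 1 = Posz i.+1 by lia.
have -> : Posz l + 1 = Posz l.+1 by lia.
apply: IHq => // t a0 a1 a2 a3 a4 a5 mu' lt' mu'lo mu'q; set t' := (X in Q X _).
have lt : (t' <= size (c :: q) * (11 * L + 60) + 1)%N by rewrite /t' /=; lia.
rewrite (addSnnS i) (addSnnS l); apply: qQ => // [k ki|].
  by rewrite mu'lo; [rewrite /upd ltn_eqF|apply: ltnW].
by apply/segment_cons; split=> //; rewrite mu'lo // /upd eqxx.
Qed.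

Lemma polyseq_last (R : nzSemiRingType) (p : {poly R}) : last 1 p != 0.
Proof. by case: p => s. Qed.


(** That the cells below [i] keep their contents protects the rows already written in the
    induction. *)
Lemma wp_write_rows (ps : seq {poly int}) mu L N (i l : nat)
    (r0 r1 r2 r3 r4 r5 r7 r8 r9 Y X r12 r13 r14 r17 r18 r19 : int) (Q : nat -> state -> Prop) :
  let vs := [seq q.[Y] | q : {poly int} <- ps] in
  balanced X vs -> last 1 vs != 0 -> `|horner_rec vs X| <= 2 ^+ L -> X <= 2 ^+ L ->
  {in ps, forall q : {poly int}, balanced Y q && (size q <= N)%N} ->
  (forall t r0 r1 r2 r3 r4 r5 r6 r7 r8 r15 r17 mu', (t <= size ps * (N * (11 * L + 60) + 11 * L + 60) + 1)%N ->
     (forall k, (k < i)%N -> mu' k = mu k) ->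
     segment mu' i (flatten [seq encode_poly q | q : {poly int} <- ps]) ->
     Q t ([:: r0; r1; r2; r3; r4; r5; r6; r7; r8; r9; Y; X; r12; r13; r14;
       r15; Posz (l + size ps)%N; r17; r18; r19], mu')) ->
  wp (While ($15 * $15)
    (0 ::= $15;; 1 ::= $11;; rdiv;; 17 ::= $15 - $2 * $11;; 15 ::= $2;;
     16 ::= $16 + %1;; 7 ::= $6;; 6 ::= $6 + %1;; 8 ::= %0;; write_row;; Write 7 $8))%cmd
    Q ([:: r0; r1; r2; r3; r4; r5; Posz i; r7; r8; r9; Y; X; r12; r13; r14;
       horner_rec vs X; Posz l; r17; r18; r19], mu).
Proof.
elim: ps mu i l r0 r1 r2 r3 r4 r5 r7 r8 r17 Q => [|q ps IHps] mu i l r0 r1 r2 r3 r4 r5 r7 r8 r17 Q /=.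
  move=> _ _ _ _ _ qQ; apply: wp_while_false => //=.
  by have := qQ 1%N r0 r1 r2 r3 r4 r5 (Posz i) r7 r8 0 r17 mu; rewrite addn0; apply.
set vs := map _ ps => bal lst leL leX hps qQ.
rewrite -[_ && _]/(balanced X (q.[Y] :: vs)) in bal; rewrite -[last _ _]/(last 1 (q.[Y] :: vs)) in lst.
have nz : horner_rec (q.[Y] :: vs) X != 0 by apply/eqP=> /(horner_rec_balanced0 bal lst).
have leL' := le_trans (horner_rec_balanced_quo bal) leL.
have /andP[hc bal'] := bal; have lst' := last_cons_neq0 lst.
have /andP[balq sq] : balanced Y q && (size q <= N)%N by apply: hps; rewrite inE eqxx.
apply: wp_while_true.
  by rewrite -[_ < _]/(0 < horner_rec (q.[Y] :: vs) X * horner_rec (q.[Y] :: vs) X); lia.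
rewrite -[_ * X + _]/(horner_rec (q.[Y] :: vs) X) in leL *.
set z := horner_rec (_ :: _) _ in nz leL *.
step; step; apply: wp_then; apply: (@wp_rdiv _ _ (horner_rec vs X) q.[Y] _ _ L) => // t1 d1 z1 lt1.
step; step; step; step; step; step.
rewrite (_ : z - _ = horner_rec q Y); last by rewrite /z /= -[horner_rec q Y]/(q.[Y]); ring.
have -> : Posz i + 1 = Posz i.+1 by lia.
have -> : Posz l + 1 = Posz l.+1 by lia.
apply: wp_then; apply: (@wp_write_row _ _ L _ 0%N) => //; first exact: polyseq_last.
  by rewrite -[horner_rec q Y]/(q.[Y]); lia.
move=> t2 a0 a1 a2 a3 a4 a5 mu1 lt2 mu1lo mu1q; apply: (@wp_write _ _ i) => //=.
rewrite add0n; apply: IHps => //.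
  by move=> q' q'ps; apply: hps; rewrite inE q'ps orbT.
move=> t3 b0 b1 b2 b3 b4 b5 b6 b7 b8 b15 b17 mu2 lt3 mu2lo mu2ps.
rewrite (addSnnS l); apply: qQ.
- have : (size q * (11 * L + 60) <= N * (11 * L + 60))%N by rewrite leq_mul2r sq orbT.
  by move: lt1 lt2 lt3; rewrite mulSn; move: (size q * _)%N (N * _)%N => u v; lia.
- move=> k ki; rewrite mu2lo; last by lia.
  by rewrite /upd ifN ?neq_ltn ?ki // mu1lo //; lia.
rewrite segment_cons segment_cat; split; last split => //.
  by rewrite mu2lo /upd ?eqxx //; lia.
apply: segment_eq mu1q => k /andP[k1 k2]; rewrite mu2lo // /upd ifN //.
by rewrite neq_ltn k1 orbT.
Qed.

Lemma wp_write_poly2 (p : {poly {poly int}}) mu L N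
    (r0 r1 r2 r3 r4 r5 r6 r7 r8 r9 Y X r12 r13 r14 r16 r17 r18 r19 : int) (Q : nat -> state -> Prop) :
  1 < Y -> X = Y ^+ N -> X <= 2 ^+ L -> (size p <= N)%N ->
  (forall i, (size (p`_i)%R <= N)%N) -> (forall i j : nat, 2 * `|p`_i`_j| < Y) ->
  `|p.[X%:P].[Y]| <= 2 ^+ L ->
  (forall t st', (t <= N * (N * (11 * L + 60) + 11 * L + 60) + 5)%N ->
     segment st'.2 0 (encode_poly2 p) -> Q t st') ->
  wp write_poly2 Q ([:: r0; r1; r2; r3; r4; r5; r6; r7; r8; r9; Y; X; r12; r13; r14;
       p.[X%:P].[Y]; r16; r17; r18; r19], mu).
Proof.
move=> Y1 eX leX pN pqN balp leL qQ; rewrite -horner2E in leL *.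
have balq : {in p : seq {poly int}, forall q : {poly int}, balanced Y q && (size q <= N)%N}.
  move=> q /(nthP 0)[i lti <-]; rewrite pqN andbT.
  by apply/(all_nthP 0) => j _; apply: balp.
(* A row has at most N balanced digits in base Y, so its value is a balanced digit in base Y^N. *)
have bal : balanced X [seq q.[Y] | q : {poly int} <- p].
  apply/allP=> c /mapP[q /balq/andP[bq sq] ->].
  apply: lt_le_trans (horner_rec_balanced_lt Y1 bq) _.
  by rewrite eX ler_eXn2l.
(* The leading row is a nonzero polynomial with balanced coefficients, so its value at Y is
   nonzero. *)
have lst : last 1 [seq q.[Y] | q : {poly int} <- p] != 0.
  have -> : last 1 [seq q.[Y] | q : {poly int} <- p] = (last 1 (p : seq {poly int})).[Y].
    by rewrite -(last_map (fun q : {poly int} => q.[Y])) hornerC.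
  have : last 1 p \in (1 : {poly int}) :: p by apply: mem_last.
  have := polyseq_last p; rewrite inE; move: (last 1 p) => q nq /predU1P[->|].
    by rewrite hornerC.
  move=> /balq/andP[bq _]; apply: contra nq => /eqP/(horner_rec_balanced0 bq (polyseq_last _)) e.
  by rewrite -size_poly_eq0 e.
rewrite /write_poly2; step; step; apply: wp_then.
apply: (@wp_write_rows p _ L N 1%N 0%N) => //.
move=> t a0 a1 a2 a3 a4 a5 a6 a7 a8 a15 a17 mu' lt _ seg.
step; apply: (@wp_write _ _ 0) => //=; apply: qQ.
  have := leq_mul pN (leqnn (N * (11 * L + 60) + 11 * L + 60)).
  by move: lt; move: (size p * _)%N (N * (_ + _ + _))%N => u v; lia.
rewrite /encode_poly2 segment_cons; split=> //.
Qed.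

(** * Composition of polynomial time phases *)

Definition poly_bounded (f : nat -> nat) : Prop :=
  exists p : {poly nat}, forall n, (f n <= p.[n])%N.

Lemma poly_bounded_const c : poly_bounded (fun=> c).
Proof. by exists c%:P => n; rewrite hornerC. Qed.

Lemma poly_bounded_id : poly_bounded id.
Proof. by exists 'X => n; rewrite hornerX. Qed.

Lemma poly_boundedD f g : poly_bounded f -> poly_bounded g ->
  poly_bounded (fun n => (f n + g n)%N).
Proof. by move=> [p hp] [q hq]; exists (p + q) => n; rewrite hornerD; apply: leq_add. Qed.

Lemma poly_boundedM f g : poly_bounded f -> poly_bounded g ->
  poly_bounded (fun n => (f n * g n)%N).
Proof. by move=> [p hp] [q hq]; exists (p * q) => n; rewrite hornerM; apply: leq_mul. Qed.

Ltac poly_bound := repeat first [ apply: poly_boundedD | apply: poly_boundedM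
  | apply: poly_bounded_const | apply: poly_bounded_id ].

Definition small (L : nat) (st : state) : Prop :=
  [/\ (1 < L)%N, forall k, (`|(st.1`_k)%R| <= 2 ^ L)%N & forall i, (`|st.2 i| <= 2 ^ L)%N].

Lemma small_norm L st k : small L st -> `|st.1`_k| <= 2 ^+ L.
Proof. by case=> _ /(_ k) h _; rewrite -abszE -(natrX int 2 L) natz lez_nat. Qed.

Section Feasible.
Variables (D : Type) (sz : D -> nat).
Implicit Types I J : D -> state -> Prop.

(** An arbitrary polynomial bound on the lengths at the start gives one at the end, so phases
    compose. Each phase may choose its levels afresh: a number computed in one phase can count as a
    constant, of level 0, in the next. *)
Definition feasible (c : program) I J : Prop :=
  forall pL : {poly nat}, exists pT pL' : {poly nat}, forall d st m,
    I d st -> represents m st -> small pL.[sz d] st ->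
    exists t m' st', [/\ exec c m t m', (t <= pT.[sz d])%N, represents m' st',
      small pL'.[sz d] st' & J d st'].

Lemma feasible_seq c1 c2 I J H :
  feasible c1 I J -> feasible c2 J H -> feasible (Seq c1 c2) I H.
Proof.
move=> h1 h2 pL; have [pT1 [pL1 {}h1]] := h1 pL; have [pT2 [pL2 {}h2]] := h2 pL1.
exists (pT1 + pT2), pL2 => d st m i r s.
have [t1 [m1 [st1 [x1 l1 r1 s1 j1]]]] := h1 d st m i r s.
have [t2 [m2 [st2 [x2 l2 r2 s2 j2]]]] := h2 d st1 m1 j1 r1 s1.
exists (t1 + t2)%N, m2, st2; split=> //; first exact: exec_seq x1 x2.
by rewrite hornerD; apply: leq_add.
Qed.

Lemma feasible_compile lv la K Dg c f I J : (0 < K)%N ->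
  leveled lv la K Dg c -> (forall k, (lv k <= Dg)%N) -> (la <= Dg)%N -> poly_bounded f ->
  (forall d st L, I d st -> small L st ->
    wp c (fun s st' => (s <= f (sz d + L)%N)%N /\ J d st') st) ->
  feasible (compile c) I J.
Proof.
move=> K0 wc lvD laD [p hp] hwp pL.
pose ps : {poly nat} := p \Po ('X + pL).
have psE n : ps.[n] = p.[(n + pL.[n])%N] by rewrite horner_comp hornerD hornerX.
have [pT hT] : poly_bounded (fun n => ps.[n] * step_cost K Dg pL.[n] (0 + ps.[n] * K))%N.
  have pb (q : {poly nat}) : poly_bounded (fun n => q.[n]) by exists q => n.
  by rewrite /step_cost /bits; poly_bound; apply: pb.
have [pL' hL'] : poly_bounded (fun n => pL.[n] * (Dg * (ps.[n] * K) + 1))%N.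
  have pb (q : {poly nat}) : poly_bounded (fun n => q.[n]) by exists q => n.
  by poly_bound; apply: pb.
exists pT, pL' => d st m i r sm; have [L1 ss sa] := sm.
have [s [st' [x [ls j]]]] := hwp d st _ i sm.
have b0 : bounded lv la pL.[sz d] 0 st.
  by split=> k; rewrite muln0 muln1; [apply: ss|apply: sa].
have [t [m' [x' r' b' lt]]] := compile_correct K0 L1 x wc r b0.
have lsp : (s <= ps.[sz d])%N by rewrite psE (leq_trans ls).
have le_exp l : (l <= Dg)%N ->
    (2 ^ (pL.[sz d] * (l * (0 + s * K) + 1)) <= 2 ^ pL'.[sz d])%N.
  move=> lD; rewrite leq_pexp2l //; apply: leq_trans (hL' _).
  by rewrite leq_mul2l leq_add2r leq_mul ?orbT // leq_mul2r lsp orbT.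
exists t, m', st'; split=> //.
- apply: leq_trans lt (leq_trans _ (hT _)); apply: leq_mul => //.
  by rewrite leq_mul2l bitsS ?orbT // leq_add2l leq_mul2r lsp orbT.
split.
- apply: leq_trans (hL' _); apply: leq_trans L1 _.
  by rewrite leq_pmulr // addn1.
- by move=> k; apply: leq_trans (proj1 b' k) (le_exp _ (lvD k)).
by move=> k; apply: leq_trans (proj2 b' k) (le_exp _ laD).
Qed.

End Feasible.

(** * The program *)

Definition base_y (n : nat) : int := 4 * 8 ^+ n.
Definition base_x (n : nat) : int := base_y n ^+ n.+1.
Definition base_w (n : nat) : int := base_x n ^+ n.+1.

(* The digits in base [base_w n] of the evaluations of [tM] and [tN] are the
   coefficients of [cs] and [ds]. *)
Record instance := Instance {
  order : nat;
  tM : {poly {poly int}};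
  tN : {poly {poly int}};
  tP : {poly {poly int}};
  cs : {poly int};
  ds : {poly int};
  eval22 : tM.[2%:P].[2] * tN.[2%:P].[2] = 2 ^+ order;
  eval_cs : tM.[(base_w order + 1)%:P].[base_y order] = cs.[base_w order];
  eval_ds : tN.[(base_x order)%:P].[base_w order + 1] = ds.[base_w order];
  eval_tP : \sum_(i < size cs) cs`_i * (\sum_(j < size ds) ds`_j *
       ((base_x order - 1) ^+ (i - j) * (base_y order - 1) ^+ (j - i))) =
    tP.[(base_x order)%:P].[base_y order];
  size_tM : (size tM <= order.+1)%N /\ forall i, (size (tM`_i)%R <= order.+1)%N;
  size_tN : (size tN <= order.+1)%N /\ forall i, (size (tN`_i)%R <= order.+1)%N;
  size_tP : (size tP <= order.+1)%N /\ forall i, (size (tP`_i)%R <= order.+1)%N;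
  size_cs : (size cs <= order.+1)%N;
  size_ds : (size ds <= order.+1)%N;
  coef_tM_le : forall i j, `|tM`_i`_j| <= 8 ^+ order;
  coef_tN_le : forall i j, `|tN`_i`_j| <= 8 ^+ order;
  coef_tP_lt : forall i j : nat, 2 * `|tP`_i`_j| < base_y order;
  balanced_cs : balanced (base_w order) cs;
  balanced_ds : balanced (base_w order) ds
}.

Definition input (d : instance) : seq int := encode_poly2 (tM d) ++ encode_poly2 (tN d).

Definition holds (vals : instance -> seq (nat * int)) (d : instance) (st : state) : Prop :=
  [/\ size st.1 = 20%N, st.2 = (fun i => (input d)`_i) &
      all (fun kv => st.1`_kv.1 == kv.2) (vals d)].

Lemma size20E (s : seq int) : size s = 20%N ->
  s = [:: s`_0; s`_1; s`_2; s`_3; s`_4; s`_5; s`_6; s`_7; s`_8; s`_9;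
          s`_10; s`_11; s`_12; s`_13; s`_14; s`_15; s`_16; s`_17; s`_18; s`_19].
Proof. by do 20 (case: s => [//|? s]); case: s. Qed.

Lemma segment_input d : segment (fun i => (input d)`_i) 0 (encode_poly2 (tM d)) /\
  segment (fun i => (input d)`_i) (size (encode_poly2 (tM d))) (encode_poly2 (tN d)).
Proof. exact/(segment_cat (fun i => (input d)`_i) 0). Qed.

Lemma coef_in_size (p : {poly {poly int}}) N : (forall i, (size (p`_i)%R <= N)%N) ->
  {in p : seq {poly int}, forall q : {poly int}, (size q <= N)%N}.
Proof. by move=> h q /(nthP 0)[i _ <-]. Qed.

Lemma wp_doubling k b mu n j s (Q : nat -> state -> Prop) :
  k \notin [:: 0; 9]%N -> b \notin [:: 0; k]%N -> size s = 20%N -> (k < 20)%N ->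
  s`_0 = 2 ^+ j -> s`_9 = 2 ^+ (j + n) ->
  (forall t s', (t <= 3 * n + 1)%N -> size s' = 20%N ->
     (forall i, i \notin [:: 0; k]%N -> s'`_i = s`_i) -> s'`_k = s`_k * s`_b ^+ n ->
     Q t (s', mu)) ->
  wp (While ($9 - $0) (0 ::= $0 + $0;; k ::= $k * $b))%cmd Q (s, mu).
Proof.
rewrite !inE !negb_or => /andP[k0 k9] /andP[b0 bk] ss k20.
elim: n j s ss Q => [|n IHn] j s ss Q s0 s9 qQ.
  apply: wp_while_false; first by rewrite /= s0 s9 addn0; lia.
  by apply: qQ; rewrite ?expr0 ?mulr1.
apply: wp_while_true.
  rewrite /= s0 s9 subr_gt0 exprD exprS.
  have : (1 : int) <= 2 ^+ n by rewrite exprn_ege1.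
  have : (0 : int) < 2 ^+ j by rewrite exprn_gt0.
  by move: (2 ^+ n) (2 ^+ j) => x y; nia.
apply: wp_then; apply: wp_set; apply: wp_set.
set s1 := set_nth 0 _ k _.
have s1E i : s1`_i = if i == k then s`_k * s`_b else if i == 0%N then s`_0 + s`_0 else s`_i.
  by rewrite /s1 !nth_set_nth /= !nth_set_nth /= !(negbTE k0) !(negbTE b0).
apply: (IHn j.+1).
- by rewrite /s1 !size_set_nth ss; move: k20; lia.
- by rewrite s1E eq_sym (negbTE k0) eqxx s0 exprS; lia.
- by rewrite s1E eq_sym (negbTE k9) /= s9 addSnnS.
move=> t s' lt ss' s'E s'k; apply: qQ => //; first by lia.
  move=> i; rewrite !inE negb_or => hi; rewrite s'E ?inE ?negb_or // s1E.
  by case/andP: hi => /negbTE-> /negbTE->.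
by rewrite s'k !s1E eqxx (negbTE bk) (negbTE b0) exprS mulrA.
Qed.

(* Scalar 9 is 2^n, by which the powers are computed with n multiplications, by
   doubling scalar 0 until it reaches scalar 9. *)
Definition phase1 : cmd := (19 ::= %0;; 7 ::= %2;; 8 ::= %2)%cmd.
Definition phase2 : cmd :=
  (eval_poly2;; 13 ::= $6;; eval_poly2;; 9 ::= $13 * $6;;
   10 ::= %4 * $9 * $9 * $9;; 11 ::= $10)%cmd.
Definition phase3 : cmd :=
  (0 ::= %1;; While ($9 - $0) (0 ::= $0 + $0;; 11 ::= $11 * $10))%cmd.
Definition phase4 : cmd :=
  (12 ::= $11;; 0 ::= %1;; While ($9 - $0) (0 ::= $0 + $0;; 12 ::= $12 * $11);;
   7 ::= $12 + %1;; 8 ::= $10;; 0 ::= %0)%cmd.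
Definition phase5 : cmd := (eval_poly2;; 13 ::= $6)%cmd.
Definition phase6 : cmd := (7 ::= $11;; 8 ::= $12 + %1)%cmd.
Definition phase7 : cmd := (eval_poly2;; 14 ::= $6)%cmd.

(** The default level 1 makes the scalars beyond the list assignable. *)
Definition levels (l : seq nat) (k : nat) : nat := nth 1%N l k.

Lemma levels_le l D k : all (fun x => x <= D)%N (1%N :: l) -> (levels l k <= D)%N.
Proof.
move=> /= /andP[D1 /all_nthP h]; rewrite /levels.
by have [lt|ge] := ltnP k (size l); [apply: h|rewrite nth_default].
Qed.

Local Notation feas := (feasible order).

Definition vals1 (d : instance) : seq (nat * int) := [:: (0%N, 0); (7%N, 2); (8%N, 2)].
Definition vals2 (d : instance) : seq (nat * int) :=
  [:: (9%N, 2 ^+ order d); (10%N, base_y (order d)); (11%N, base_y (order d))].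
Definition vals3 (d : instance) : seq (nat * int) :=
  [:: (9%N, 2 ^+ order d); (10%N, base_y (order d)); (11%N, base_x (order d))].
Definition vals4 (d : instance) : seq (nat * int) :=
  [:: (0%N, 0); (7%N, base_w (order d) + 1); (8%N, base_y (order d));
      (10%N, base_y (order d)); (11%N, base_x (order d)); (12%N, base_w (order d))].
Definition vals5 (d : instance) : seq (nat * int) :=
  [:: (0%N, Posz (size (encode_poly2 (tM d)))); (10%N, base_y (order d));
      (11%N, base_x (order d)); (12%N, base_w (order d)); (13%N, (cs d).[base_w (order d)])].
Definition vals6 (d : instance) : seq (nat * int) :=
  (7%N, base_x (order d)) :: (8%N, base_w (order d) + 1) :: vals5 d.
Definition vals7 (d : instance) : seq (nat * int) :=
  [:: (10%N, base_y (order d)); (11%N, base_x (order d)); (12%N, base_w (order d));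
      (13%N, (cs d).[base_w (order d)]); (14%N, (ds d).[base_w (order d)])].

Lemma feasible1 : feas (compile phase1)
  (fun d st => st = ([::], fun i => (input d)`_i)) (holds vals1).
Proof.
apply: (@feasible_compile _ _ (levels [::]) 0 20 12 _ (fun=> 3%N)) => //.
- by move=> k; apply: levels_le.
- by poly_bound.
(* Assigning scalar 19 first extends the empty list of scalars to the length 20 that [holds]
   demands, filled with zeros. *)
by move=> d st L -> _; step; step; apply: wp_set.
Qed.

Lemma feasible2 : feas (compile phase2) (holds vals1) (holds vals2).
Proof.
(* Scalar 6 sums products of two scalars of level 1, so it has level 2; the product of two such
   values has level 4, and its cube level 12. *)
apply: (@feasible_compile _ _ (levels [:: 1; 1; 1; 1; 1; 1; 2; 0; 0; 4; 12; 12; 1; 2]%N) 0 20 12 _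
  (fun x => 2 * ((x + 1) * (6 * (x + 1) + 8) + 5) + 10)%N) => //.
- by move=> k; apply: levels_le.
- by poly_bound.
move=> d [s mu] L [/= /size20E es -> /and4P[/eqP s0 /eqP s7 /eqP s8 _]] _; rewrite es s0 s7 s8.
have [segM segN] := segment_input d.
have [szM szM'] := size_tM d; have [szN szN'] := size_tN d.
apply: wp_then; apply: (@wp_eval_poly2 (tM d) _ 0%N);
  [exact: segM|exact: coef_in_size szM'|] => t1 a2 a3 a4 a5 lt1.
step; apply: wp_then; apply: (@wp_eval_poly2 (tN d));
  [exact: segN|exact: coef_in_size szN'|] => t2 b2 b3 b4 b5 lt2.
step; step; apply: wp_set => /=; split.
  have hM : (size (tM d) * (6 * (order d).+1 + 8) <= (order d + L + 1) * (6 * (order d + L + 1) + 8))%N.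
    by apply: leq_mul; lia.
  have hN : (size (tN d) * (6 * (order d).+1 + 8) <= (order d + L + 1) * (6 * (order d + L + 1) + 8))%N.
    by apply: leq_mul; lia.
  by move: lt1 lt2 hM hN; move: (_ * _)%N (size (tN d) * _)%N ((_ + 1) * _)%N => u v w; lia.
split=> //=; rewrite eval22 eqxx /base_y /= andbT andbb; apply/eqP.
(* The cube of 2^n is 8^n. *)
by rewrite -!mulrA -!exprMn.
Qed.

Lemma feasible3 : feas (compile phase3) (holds vals2) (holds vals3).
Proof.
(* Scalar 10 is now of level 0, so repeated multiplication by it keeps the level of scalar 11. *)
apply: (@feasible_compile _ _ (levels [:: 1; 1; 1; 1; 1; 1; 1; 1; 1; 0; 0; 1]%N) 0 20 12 _
  (fun x => 3 * x + 2)%N) => //.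
- by move=> k; apply: levels_le.
- by poly_bound.
move=> d [s mu] L [/= ss -> /and4P[/eqP s9 /eqP s10 /eqP s11 _]] _.
apply: wp_then; apply: wp_set; apply: (@wp_doubling 11 10 _ (order d) 0) => //=.
- by rewrite size_set_nth ss.
- by rewrite nth_set_nth.
- by rewrite nth_set_nth /= s9.
move=> t s' lt ss' s'E s'11; split; first by lia.
split=> //=; rewrite s'11 !s'E // !nth_set_nth /= s9 s10 s11 !eqxx /=.
by rewrite andbT /base_x exprS.
Qed.

Lemma feasible4 : feas (compile phase4) (holds vals3) (holds vals4).
Proof.
apply: (@feasible_compile _ _ (levels [:: 1; 1; 1; 1; 1; 1; 1; 1; 1; 0; 0; 0; 1]%N) 0 20 12 _
  (fun x => 3 * x + 6)%N) => //.
- by move=> k; apply: levels_le.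
- by poly_bound.
move=> d [s mu] L [/= ss -> /and4P[/eqP s9 /eqP s10 /eqP s11 _]] _.
apply: wp_then; apply: wp_set; apply: wp_then; apply: wp_set.
apply: wp_then; apply: (@wp_doubling 12 11 _ (order d) 0) => //=.
- by rewrite !size_set_nth ss.
- by rewrite nth_set_nth.
- by rewrite !nth_set_nth /= !nth_set_nth /= s9.
move=> t s' lt ss' s'E s'12.
apply: wp_then; apply: wp_set; apply: wp_then; apply: wp_set; apply: wp_set => /=; split; first by lia.
have e10 : s'`_10 = base_y (order d) by rewrite s'E // !nth_set_nth /= !nth_set_nth.
have e11 : s'`_11 = base_x (order d) by rewrite s'E // !nth_set_nth /= !nth_set_nth.
have e12 : s'`_12 = base_w (order d).
  by rewrite s'12 !nth_set_nth /= !nth_set_nth /= s11 /base_w exprS.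
split=> /=; [by rewrite !size_set_nth ss'|by []|].
by rewrite !nth_set_nth /= !nth_set_nth /= !nth_set_nth /= e10 e11 e12 !eqxx.
Qed.

Lemma feasible5 : feas (compile phase5) (holds vals4) (holds vals5).
Proof.
apply: (@feasible_compile _ _ (levels [:: 1; 1; 1; 1; 1; 1; 2; 0; 0; 1; 1; 1; 1; 2]%N) 0 20 12 _
  (fun x => (x + 1) * (6 * (x + 1) + 8) + 6)%N) => //.
- by move=> k; apply: levels_le.
- by poly_bound.
move=> d [s mu] L [/= /size20E es -> /and5P[/eqP s0 /eqP s7 /eqP s8 /eqP s10 /and3P[/eqP s11 /eqP s12 _]]] _.
rewrite es s0 s7 s8 s10 s11 s12.
have [segM _] := segment_input d; have [szM szM'] := size_tM d.
apply: wp_then; apply: (@wp_eval_poly2 (tM d) _ 0%N);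
  [exact: segM|exact: coef_in_size szM'|] => t1 a2 a3 a4 a5 lt1.
apply: wp_set => /=; split.
  have hM : (size (tM d) * (6 * (order d).+1 + 8) <= (order d + L + 1) * (6 * (order d + L + 1) + 8))%N.
    by apply: leq_mul; lia.
  by move: lt1 hM; move: (_ * _)%N ((_ + 1) * _)%N => u w; lia.
by split=> //=; rewrite eval_cs !eqxx.
Qed.

Lemma feasible6 : feas (compile phase6) (holds vals5) (holds vals6).
Proof.
apply: (@feasible_compile _ _ (levels [::]) 0 20 12 _ (fun=> 2%N)) => //.
- by move=> k; apply: levels_le.
- by poly_bound.
move=> d [s mu] L [/= ss -> /and5P[/eqP s0 /eqP s10 /eqP s11 /eqP s12 /andP[/eqP s13 _]]] _.
apply: wp_then; apply: wp_set; apply: wp_set; split=> //; split=> //=.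
  by rewrite !size_set_nth ss.
by rewrite !nth_set_nth /= !nth_set_nth /= s0 s10 s11 s12 s13 !eqxx.
Qed.

Lemma feasible7 : feas (compile phase7) (holds vals6) (holds vals7).
Proof.
apply: (@feasible_compile _ _ (levels [:: 1; 1; 1; 1; 1; 1; 2; 0; 0; 1; 1; 1; 1; 1; 2]%N) 0 20 12 _
  (fun x => (x + 1) * (6 * (x + 1) + 8) + 6)%N) => //.
- by move=> k; apply: levels_le.
- by poly_bound.
move=> d [s mu] L [/= /size20E es -> /and5P[/eqP s7 /eqP s8 /eqP s0 /eqP s10 /and4P[/eqP s11 /eqP s12 /eqP s13 _]]] _.
rewrite es s0 s7 s8 s10 s11 s12 s13.
have [_ segN] := segment_input d; have [szN szN'] := size_tN d.
apply: wp_then; apply: (@wp_eval_poly2 (tN d));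
  [exact: segN|exact: coef_in_size szN'|] => t1 a2 a3 a4 a5 lt1.
apply: wp_set => /=; split.
  have hN : (size (tN d) * (6 * (order d).+1 + 8) <= (order d + L + 1) * (6 * (order d + L + 1) + 8))%N.
    by apply: leq_mul; lia.
  by move: lt1 hN; move: (_ * _)%N ((_ + 1) * _)%N => u w; lia.
by split=> //=; rewrite eval_ds !eqxx.
Qed.

Definition vals8 (d : instance) : seq (nat * int) :=
  [:: (10%N, base_y (order d)); (11%N, base_x (order d));
      (15%N, (tP d).[(base_x (order d))%:P].[base_y (order d)])].

Lemma feasible8 : feas (compile combine) (holds vals7) (holds vals8).
Proof.
apply: (@feasible_compile _ _ (levels [:: 1; 1; 1; 1; 1; 1; 1; 1; 1; 1; 0; 0; 0; 1; 0; 2; 1; 1; 2; 1]%N) 0 20 12 _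
  (fun x => (x + 1) * ((x + 1) * (11 * x + 6 * (x + 1) + 60) + 11 * x + 60) + 3)%N) => //.
- by move=> k; apply: levels_le.
- by poly_bound.
move=> d [s mu] L [/= /size20E es -> /and5P[/eqP s10 /eqP s11 /eqP s12 /eqP s13 /andP[/eqP s14 _]]] sm.
have h13 := small_norm 13 sm; have h14 := small_norm 14 sm; rewrite /= s13 s14 in h13 h14.
rewrite es s10 s11 s12 s13 s14.
apply: (@wp_combine (cs d) (ds d) _ L (order d).+1) => //.
- exact: balanced_cs.
- exact: polyseq_last.
- exact: size_cs.
- exact: balanced_ds.
- exact: polyseq_last.
- exact: size_ds.
move=> t a0 a1 a2 a3 a4 a5 a6 a7 a8 a13 a16 a17 a18 a19 lt; split.
  apply: leq_trans lt _; rewrite leq_add2r; apply: leq_mul; first by lia.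
  rewrite leq_add2r leq_add //; last by lia.
  by apply: leq_mul; lia.
by split=> //=; rewrite eval_tP !eqxx.
Qed.

Lemma base_y_gt1 n : 1 < base_y n.
Proof.
have : (1 : int) <= 8 ^+ n by rewrite exprn_ege1.
by rewrite /base_y; lia.
Qed.


Lemma feasible9 : feas (compile write_poly2) (holds vals8)
  (fun d st => segment st.2 0 (encode_poly2 (tP d))).
Proof.
apply: (@feasible_compile _ _ (levels [:: 1; 1; 1; 1; 1; 1; 1; 1; 1; 1; 0; 0]%N) 1 20 12 _
  (fun x => (x + 1) * ((x + 1) * (11 * x + 60) + 11 * x + 60) + 5)%N) => //.
- by move=> k; apply: levels_le.
- by poly_bound.
move=> d [s mu] L [/= /size20E es -> /and4P[/eqP s10 /eqP s11 /eqP s15 _]] sm.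
have h11 := small_norm 11 sm; have h15 := small_norm 15 sm; rewrite /= s11 s15 in h11 h15.
rewrite es s10 s11 s15.
apply: (@wp_write_poly2 (tP d) _ L (order d).+1) => //.
- exact: base_y_gt1.
- by apply: le_trans h11; apply: ler_norm.
- by case: (size_tP d).
- by case: (size_tP d).
- exact: coef_tP_lt.
move=> t st' lt seg; split=> //.
apply: leq_trans lt _; rewrite leq_add2r; apply: leq_mul; first by lia.
rewrite leq_add2r leq_add //; last by lia.
by apply: leq_mul; lia.
Qed.


Lemma feasible_algorithm : exists c, feas c
  (fun d st => st = ([::], fun i => (input d)`_i))
  (fun d st => segment st.2 0 (encode_poly2 (tP d))).
Proof.
eexists.
apply: feasible_seq feasible1 _; apply: feasible_seq feasible2 _.
apply: feasible_seq feasible3 _; apply: feasible_seq feasible4 _.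
apply: feasible_seq feasible5 _; apply: feasible_seq feasible6 _.
apply: feasible_seq feasible7 _; exact: feasible_seq feasible8 feasible9.
Qed.

Lemma norm_le_exp2 (c : int) n : `|c| <= 8 ^+ n -> (`|c| <= 2 ^ (3 * n + 3))%N.
Proof.
rewrite -abszE -(natrX int 8 n) natz lez_nat => h.
by apply: leq_trans h _; rewrite expnD expnM leq_pmulr.
Qed.

Lemma encode_poly2_le (p : {poly {poly int}}) n c :
  (size p <= n.+1)%N /\ (forall i, (size (p`_i)%R <= n.+1)%N) ->
  (forall i j, `|p`_i`_j| <= 8 ^+ n) -> c \in encode_poly2 p -> (`|c| <= 2 ^ (3 * n + 3))%N.
Proof.
have sz (s : nat) : (s <= n.+1)%N -> (s <= 2 ^ (3 * n + 3))%N.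
  by move=> sn; apply: leq_trans (ltnW (ltn_expl _ (isT : (1 < 2)%N))); lia.
move=> [sp sq] cp; rewrite inE => /predU1P[->|]; first exact: sz.
case/flattenP=> w /mapP[q qp ->]; rewrite inE => /predU1P[->|].
  by apply: sz; have := coef_in_size sq qp.
by case/(nthP 0)=> j _ <-; case/(nthP 0): qp => i _ <-; apply: norm_le_exp2.
Qed.

Lemma input_le d (i : nat) : (`|((input d)`_i)%R| <= 2 ^ (3 * order d + 3))%N.
Proof.
have [lt|ge] := ltnP i (size (input d)); last by rewrite nth_default.
have := mem_nth 0 lt; rewrite mem_cat => /orP[].
  exact: encode_poly2_le (size_tM d) (@coef_tM_le d).
exact: encode_poly2_le (size_tN d) (@coef_tN_le d).
Qed.

(** * The instance given by a free product *)

Section FreeProductInstance.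
Variables (T : finType) (M N P : matroid T).
Hypotheses (dMN : [disjoint ground M & ground N]) (fpP : is_free_product M N P).

Local Notation n := (#|ground M| + #|ground N|)%N.

Lemma free_product_instance : exists d,
  [/\ order d = n, tM d = tutte M, tN d = tutte N & tP d = tutte P].
Proof.
have cP := card_free_product_ground dMN fpP.
have y1 : 1 < base_y n := base_y_gt1 n.
have x1 : 1 < base_x n by rewrite /base_x exprn_egt1.
have w1 : 1 < base_w n by rewrite /base_w exprn_egt1.
have le_n k (x : int) m : (k <= m)%N -> 1 <= x -> x ^+ k <= x ^+ m.
  by move=> km x0; rewrite ler_weXn2l.
have two8 : (2 : int) ^+ n <= 8 ^+ n by rewrite lerXn2r ?nnegrE.
have two_lt_y : 2 * 2 ^+ n < base_y n.
  have : (0 : int) < 8 ^+ n by rewrite exprn_gt0.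
  by rewrite /base_y; move: two8; lia.
have y_le_x : base_y n <= base_x n by rewrite /base_x -{1}[base_y n]expr1 ler_weXn2l // ltW.
have x_le_w : base_x n <= base_w n by rewrite /base_w -{1}[base_x n]expr1 ler_weXn2l // ltW.
(* Since 2 times 2^n is less than z, twice the bound on [c] is less than z times z^n. This is
   applied with z = [base_y n] to the C_a and with z = [base_x n] to the D_m. *)
have digit (z : int) k (c : int) : (k <= n)%N -> base_y n <= z ->
    `|c| <= 2 ^+ k * z ^+ k -> 2 * `|c| < z ^+ n.+1.
  move=> kn yz hc; have z1 : 1 <= z by apply: ltW (lt_le_trans y1 yz).
  have hk : (2 : int) ^+ k <= 2 ^+ n by apply: le_n.
  have hz : z ^+ k <= z ^+ n by apply: le_n.
  have z0 : 0 < z ^+ n by rewrite exprn_gt0 // (lt_le_trans _ z1).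
  have : 2 ^+ k * z ^+ k <= 2 ^+ n * z ^+ n.
    by apply: ler_pM; rewrite ?exprn_ge0 // (le_trans _ z1).
  rewrite exprS; move: hc two_lt_y yz z0.
  by move: (2 ^+ k * z ^+ k) (2 ^+ n) (z ^+ n) (base_y n) => a b e y; nia.
have balM : balanced (base_w n) (corank_poly M (base_y n)).
  apply/(all_nthP 0) => i _; apply: lt_le_trans x_le_w.
  apply: (digit _ #|ground M|) => //; first exact: leq_addr.
  by apply: coef_corank_poly_le; apply: ltW.
have balN : balanced (base_w n) (nullity_poly N (base_x n)).
  apply/(all_nthP 0) => i _; apply: (digit _ #|ground N|) => //; first exact: leq_addl.
  by apply: coef_nullity_poly_le; apply: ltW.
have leM : (#|ground M| <= n)%N := leq_addr _ _.
have leN : (#|ground N| <= n)%N := leq_addl _ _.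
have leSn m k l : (k <= m.+1)%N -> (m <= l)%N -> (k <= l.+1)%N by lia.
have coefP (i j : nat) : 2 * `|(tutte P)`_i`_j| < base_y n.
  have := coef_tutte_le P i j; rewrite cP /base_y.
  have : (0 : int) < 8 ^+ n by rewrite exprn_gt0.
  by lia.
unshelve eexists.
  apply: (@Instance n (tutte M) (tutte N) (tutte P)
    (corank_poly M (base_y n)) (nullity_poly N (base_x n))).
  - by rewrite !horner_tutte22 exprD.
  - by rewrite horner_corank_poly.
  - by rewrite horner_nullity_poly.
  - exact: free_product_tutte.
  - by split=> [|i]; [apply: leSn (size_tutte M) leM|apply: leSn (size_coef_tutte M i) leM].
  - by split=> [|i]; [apply: leSn (size_tutte N) leN|apply: leSn (size_coef_tutte N i) leN].
  - by rewrite -cP; split=> [|i]; [apply: size_tutte|apply: size_coef_tutte].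
  - exact: leSn (size_corank_poly M _) leM.
  - exact: leSn (size_nullity_poly N _) leN.
  - by move=> i j; apply: le_trans (coef_tutte_le M i j) _; apply: le_n.
  - by move=> i j; apply: le_trans (coef_tutte_le N i j) _; apply: le_n.
  - exact: coefP.
  - exact: balM.
  - exact: balN.
by split.
Qed.

End FreeProductInstance.

Theorem theorem4p4 :
  exists (c : program) (b : {poly nat}),
    forall (T : finType) (M N P : matroid T),
      [disjoint ground M & ground N] ->
      is_free_product M N P ->
      computes_within c
        (encode_poly2 (tutte M) ++ encode_poly2 (tutte N))
        (encode_poly2 (tutte P))
        b.[(#|ground M| + #|ground N|)%N].
Proof.
have [c hc] := feasible_algorithm.
(* The input consists of coefficients, at most 8^n in absolute value, and lengths, at most n + 1;
   all are bounded by 2^(3n + 3). The constant 3 also keeps the exponent above 1 when n = 0. *)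
have [pT [pL {}hc]] := hc (3%:P * 'X + 3%:P).
exists c, pT => T M N P dMN fpP.
have [d [od eM eN eP]] := free_product_instance dMN fpP.
have pLE : (3%:P * 'X + 3%:P : {poly nat}).[order d] = (3 * order d + 3)%N.
  by rewrite hornerD hornerM !hornerC hornerX.
have rep0 : represents (input_memory (input d)) ([::], fun i => (input d)`_i).
  by split=> //= k; rewrite nth_nil.
have small0 : small (3%:P * 'X + 3%:P : {poly nat}).[order d] ([::], fun i => (input d)`_i).
  rewrite pLE; split=> [|k|i] /=; first by rewrite addnS ltnS addnC.
    by rewrite nth_nil.
  exact: input_le.
have [t [m [st [x lt [_ rm] _ seg]]]] := hc d _ _ erefl rep0 small0.
exists t, m; rewrite -eM -eN -eP -od; split=> // i lti.
by rewrite rm; have := seg i lti; rewrite add0n.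
Qed.
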